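(* Let $X$ and $Y$ be finite sets of nonnegative numbers less than $1$. For each $i, j \in \mathbb{Z}$, let $$L(i,j) = \frac{1}{4\pi^2} \oint \oint \frac{1}{w-z} \left( \frac{F(Y; \{w^{-1}\})\, F(X; \{z\})}{F(Y; \{z^{-1}\})\, F(X; \{w\})} \right) w^{j} z^{-i-1}\, dw\, dz,$$ where the contours are taken along the positively oriented circles $|z| = r_1$ and $|w| = r_2$, where $r_1$ and $r_2$ are any positive reals satisfying $\max X, \max Y < r_2 < r_1 < \min(X^{-1}), \min(Y^{-1})$. Then, for any finite subset $T = \{t_1, t_2, \ldots, t_d\} \subset \mathbb{Z}$, $$\rho_{\mathbf{SM}}(T) = \det \mathbf{L}_T,$$ where $\mathbf{L}_T$ is the $d \times d$ matrix whose $(r,c)$ entry is $L(t_r, t_c)$.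
   Context: $\mathbb{Y}$ is the set of all partitions $\lambda = (\lambda_1, \lambda_2, \ldots)$ (nonincreasing sequences of nonnegative integers with finite sum), $\ell(\lambda)$ is the number of positive parts of $\lambda$, and $s_\lambda(X)$ is the Schur polynomial in the variables $X$ associated with $\lambda$ (equal to $0$ if $|X| < \ell(\lambda)$). $F(X;Y) = \prod_{(x,y) \in X \times Y} (1-xy)^{-1}$. For a subset $S \subset \mathbb{C} \setminus \{0\}$, $S^{-1} = \{s^{-1}\}_{s \in S}$. The Schur measure is the probability measure on $\mathbb{Y}$ given by $\mathbf{SM}(\lambda) = s_\lambda(X) s_\lambda(Y) / F(X;Y)$. For $\lambda \in \mathbb{Y}$ let $\mathcal{X}(\lambda)$ be the finite subset $\{\lambda_1 - 1, \lambda_2 - 2, \ldots, \lambda_{\ell(\lambda)} - \ell(\lambda)\} \subset \mathbb{Z}$. For a finite set $T \subset \mathbb{Z}$, the correlation function is $\rho_{\mathbf{SM}}(T) = \sum_{\lambda \in \mathbb{Y}} \mathbf{1}_{T \subseteq \mathcal{X}(\lambda)} \mathbf{SM}(\lambda)$, i.e. the probability that $T \subseteq \mathcal{X}(\lambda)$ when $\lambda$ is chosen under the Schur measure.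
   Formalization: With X(λ) cut at ℓ(λ) the claim fails for negative T (X=Y={0}, T={-1}: ρ=0 but L(-1,-1)=1). Proved: for every finite T with X(λ) = {λ_i - i : i ≥ 1} (λ_i = 0 past ℓ(λ)), and with the finite X(λ) as stated when all elements of T are nonnegative. *)

(* Defs.v *)
From HB Require Import structures.
From mathcomp Require Import all_boot all_order all_algebra.
From mathcomp Require Import finmap complex.
From mathcomp Require Import all_classical all_reals all_analysis.

Set Implicit Arguments.
Unset Strict Implicit.
Unset Printing Implicit Defensive.

Import Order.TTheory GRing.Theory Num.Theory.

Local Open Scope classical_set_scope.
Local Open Scope ring_scope.
Local Open Scope complex_scope.

(* A partition is the list of its positive parts: lambda_(i+1) is
   [nth 0%N lam i] for every i, and ell(lambda) is [size lam]. *)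
Definition partitions : set (seq nat) :=
  [set lam | sorted geq lam && (0%N \notin lam)].

(* Ratio of alternants det(x_i^(lam_j + n - j)) / det(x_i^(n - j)), j = 1..n;
   it is the value of the Schur polynomial when the x_i are pairwise distinct,
   and then does not depend on the order of [xs]. *)
Definition schur (K : fieldType) (xs : seq K) (lam : seq nat) : K :=
  let n := size xs in
  if (size lam <= n)%N then
    \det (\matrix_(i < n, j < n) (nth 0 xs i ^+ (nth 0%N lam j + (n - j.+1)))) /
    \det (\matrix_(i < n, j < n) (nth 0 xs i ^+ (n - j.+1)))
  else 0.

Definition cauchyF (K : fieldType) (xs ys : seq K) : K :=
  \prod_(x <- xs) \prod_(y <- ys) (1 - x * y)^-1.

Definition schur_measure (R : realType) (X Y : {fset R}) (lam : seq nat) : R :=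
  schur X lam * schur Y lam / cauchyF X Y.

(* {lam_i - i : i >= 1}; contains every sufficiently negative integer. *)
Definition particles (lam : seq nat) : set int :=
  [set k | exists i : nat, k = (nth 0%N lam i)%:Z - i.+1%:Z].

(* {lam_i - i : 1 <= i <= ell(lam)}.  It has the same nonnegative elements as
   [particles lam], but in general not the same negative ones: [particles]
   of the empty partition is the set of all negative integers, whereas
   [particles_trunc] of it is empty. *)
Definition particles_trunc (lam : seq nat) : set int :=
  [set k | exists2 i : nat, (i < size lam)%N
                          & k = (nth 0%N lam i)%:Z - i.+1%:Z].

(* Correlation function of the point configuration [conf lam] when lam follows
   the Schur measure.  [esum] is a supremum of finite partial sums, hence the sum
   of the family when its terms are nonnegative; they are if X, Y >= 0. *)
Definition correlation (R : realType) (X Y : {fset R})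
    (conf : seq nat -> set int) (T : set int) : \bar R :=
  \esum_(lam in partitions)
    (\1_[set mu | T `<=` conf mu] lam * schur_measure X Y lam)%:E.

Definition circle (R : realType) (r theta : R) : R[i] :=
  (r * cos theta) +i* (r * sin theta).

(* The derivative of [circle r] at theta. *)
Definition circle_speed (R : realType) (r theta : R) : R[i] :=
  (- (r * sin theta)) +i* (r * cos theta).

Definition circle_integral (R : realType) (r : R) (f : R[i] -> R[i]) : R[i] :=
  let g (theta : R) := f (circle r theta) * circle_speed r theta in
  Rintegral lebesgue_measure `[0, 2 * pi] (fun theta => complex.Re (g theta))
  +i*
  Rintegral lebesgue_measure `[0, 2 * pi] (fun theta => complex.Im (g theta)).

Definition kernelL (R : realType) (X Y : {fset R}) (r1 r2 : R) (i j : int)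
    : R[i] :=
  let X' := [seq x%:C | x <- X] in
  let Y' := [seq y%:C | y <- Y] in
  (4 * pi ^+ 2)^-1%:C *
  circle_integral r1 (fun z => circle_integral r2 (fun w =>
    (w - z)^-1 *
    ((cauchyF Y' [:: w^-1] * cauchyF X' [:: z]) /
     (cauchyF Y' [:: z^-1] * cauchyF X' [:: w])) *
    w ^ j * z ^ (- i - 1))).

(* Main.v *)
Require Import Defs.
From mathcomp Require Import all_boot all_order all_algebra.
From mathcomp Require Import fingroup perm ring lra zify.
From mathcomp Require Import finmap complex.
From mathcomp Require Import all_classical all_reals all_analysis.

Set Implicit Arguments.
Unset Strict Implicit.
Unset Printing Implicit Defensive.

Import Order.TTheory GRing.Theory Num.Theory.
Import numFieldNormedType.Exports.

Local Open Scope classical_set_scope.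
Local Open Scope ring_scope.
Local Open Scope complex_scope.

(** For pairwise distinct variables the Schur measure is a biorthogonal ensemble,
    and its correlations are computed in a window where every determinant is
    finite.  Fix N at least |X| + |Y|, and so large that t + N >= 0 for every t
    in T.  A partition with at most N parts is the strictly increasing function f
    on N points given by f(i) = lam_(N-i) + i, and t belongs to the particle set
    if and only if t + N is a value of f.  Partitions with more than N parts have
    probability zero.

    The Jacobi-Trudi formula (schur_jacobi_trudi) turns both Schur functions into
    N x N minors, on the columns selected by f, of the matrices h_(k-p)(X) and
    h_(k-q)(Y).  Giving the weight u to every k in T + N and 1 to the others,
    the Cauchy-Binet formula (cauchy_binet) sums the products of minors to a
    determinant of size N which is a polynomial in u; its coefficient of degree
    |T| is the sum over the f whose values contain T + N
    (sum_minors_containing).  Letting the range of f grow, the Gram matrix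
    converges to the Toeplitz matrix G of the series F(Y;z) F(X;1/z), and the
    coefficient becomes det G times a determinant of size |T|
    (coef_tilted_det, cvg_sum_minors).

    It remains to compute three things.  First, det G = F(X;Y), which is the
    Cauchy identity (det_toeplitz): removing one variable x from X multiplies the
    determinant by the product of the (1 - x y) and lowers N by one.  Second, the
    entries of the small determinant are K(k,l) = delta_kl - sum_(r >= N)
    a_(k-r) b_(r-l), where a and b are the Laurent coefficients of
    F(X;z) / F(Y;1/z) and of its inverse; K is the projection onto the span of
    the h_(k-p)(X) along the orthogonal of the span of the h_(l-q)(Y)
    (sum_kernel_row_hsymZ, sum_kernel_row_gram).  Third, the double contour
    integral L(k-N,l-N) has the same value (kernelL_corr_kernel).

    The contour integrals are evaluated without residue calculus.  Removing a
    factor 1 - x z, 1 - y / z or w - z from an integrand gives a first order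
    recurrence in the exponent, and the expected closed form satisfies the same
    recurrence.  The difference is then a geometric sequence of ratio x which is
    also bounded by a geometric sequence of larger ratio in the direction of
    minus infinity, so it vanishes (geometric_unique).  Only linearity, the
    integrals of the powers z^k and an upper bound for the modulus of an
    integral are used.

    The sum over partitions is a supremum of finite sums, so its terms must be
    nonnegative for the limit above to compute it.  Nonnegativity of the minors
    of h_(k-p)(X) is total positivity (det_hsymZ_ge0): by Cauchy-Binet it
    reduces to one variable, where a minor is either zero or a power of x. *)

(** * Sequences indexed by the integers and their difference operators *)

Section Sequences.
Variable R : comNzRingType.
Implicit Types (f g : int -> R) (xs ys : seq R) (s : int) (x : R).

Definition delta (s : int) : R := (s == 0)%:R.

(** The sequence f is read as the coefficients of a formal Laurent series in z;
    bdiff multiplies it by the product of the (1 - x z), and fdiff by the product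
    of the (1 - x / z). *)
Definition bdiff xs f : int -> R :=
  foldr (fun x g s => g s - x * g (s - 1)) f xs.

Definition fdiff xs f : int -> R :=
  foldr (fun x g s => g s - x * g (s + 1)) f xs.

(** The coefficients of the product of the (1 - x z), that is, the elementary
    symmetric functions with alternating signs. *)
Definition signed_esym xs := bdiff xs delta.

(** Complete homogeneous symmetric functions, by expansion in the first variable. *)
Fixpoint hsym xs (k : nat) : R :=
  if xs is x :: xs' then \sum_(j < k.+1) x ^+ j * hsym xs' (k - j)
  else (k == 0%N)%:R.

Definition hsymZ xs (s : int) : R := if s is Posz k then hsym xs k else 0.

Lemma bdiff_cons x xs f s : bdiff (x :: xs) f s = bdiff xs f s - x * bdiff xs f (s - 1).
Proof. by []. Qed.

Lemma fdiff_cons x xs f s : fdiff (x :: xs) f s = fdiff xs f s - x * fdiff xs f (s + 1).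
Proof. by []. Qed.

Lemma eq_bdiff xs f g : f =1 g -> bdiff xs f =1 bdiff xs g.
Proof. by move=> fg; elim: xs => //= x xs IH s; rewrite !IH. Qed.

Lemma eq_fdiff xs f g : f =1 g -> fdiff xs f =1 fdiff xs g.
Proof. by move=> fg; elim: xs => //= x xs IH s; rewrite !IH. Qed.

Lemma bdiff_shift xs f (c : int) s : bdiff xs (fun s => f (s + c)) s = bdiff xs f (s + c).
Proof.
elim: xs s => //= x xs IH s; rewrite !IH.
by congr (_ - _ * bdiff _ _ _); ring.
Qed.

Lemma fdiff_shift xs f (c : int) s : fdiff xs (fun s => f (s + c)) s = fdiff xs f (s + c).
Proof.
elim: xs s => //= x xs IH s; rewrite !IH.
by congr (_ - _ * fdiff _ _ _); ring.
Qed.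

Lemma bdiff_rev xs f (c : int) s : bdiff xs (fun s => f (c - s)) s = fdiff xs f (c - s).
Proof.
elim: xs s => //= x xs IH s; rewrite !IH.
by congr (_ - _ * fdiff _ _ _); ring.
Qed.

Lemma fdiff_rev xs f (c : int) s : fdiff xs (fun s => f (c - s)) s = bdiff xs f (c - s).
Proof.
elim: xs s => //= x xs IH s; rewrite !IH.
by congr (_ - _ * bdiff _ _ _); ring.
Qed.

Lemma bdiff_lin xs f g x s :
  bdiff xs (fun s => f s - x * g s) s = bdiff xs f s - x * bdiff xs g s.
Proof. by elim: xs s => //= y ys IH s; rewrite !IH; ring. Qed.

Lemma fdiff_lin xs f g x s :
  fdiff xs (fun s => f s - x * g s) s = fdiff xs f s - x * fdiff xs g s.
Proof. by elim: xs s => //= y ys IH s; rewrite !IH; ring. Qed.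

Lemma bdiff_fdiff xs ys f : bdiff xs (fdiff ys f) =1 fdiff ys (bdiff xs f).
Proof.
move=> s; elim: ys s => //= y ys IH s; rewrite -!IH bdiff_lin.
by rewrite bdiff_shift.
Qed.

Lemma bdiff_headC x xs f s :
  bdiff xs (fun s => f s - x * f (s - 1)) s = bdiff xs f s - x * bdiff xs f (s - 1).
Proof. by rewrite bdiff_lin bdiff_shift. Qed.

Lemma hsymS x xs k : hsym (x :: xs) k.+1 = hsym xs k.+1 + x * hsym (x :: xs) k.
Proof.
rewrite /= big_ord_recl expr0 mul1r subn0; congr (_ + _).
rewrite mulr_sumr; apply: eq_bigr => j _.
by rewrite lift0 exprS subSS mulrA.
Qed.

Lemma hsymZ_cons x xs s : hsymZ (x :: xs) s - x * hsymZ (x :: xs) (s - 1) = hsymZ xs s.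
Proof.
case: s => [[|k]|k].
- by rewrite /= big_ord_recl big_ord0 expr0 /=; ring.
- have -> : Posz k.+1 - 1 = k by lia.
  by rewrite /hsymZ hsymS addrK.
- have -> : Negz k - 1 = Negz k.+1 by lia.
  by rewrite /= mulr0 subr0.
Qed.

Lemma hsymZ_nil s : hsymZ [::] s = delta s.
Proof. by case: s. Qed.

(** The generating series of the complete homogeneous functions is the inverse
    of the product of the (1 - x z). *)
Lemma bdiff_hsymZ xs : bdiff xs (hsymZ xs) =1 delta.
Proof.
elim: xs => [|x xs IH] s; first exact: hsymZ_nil.
rewrite bdiff_cons -bdiff_headC -IH; apply: eq_bdiff => {}s; exact: hsymZ_cons.
Qed.

Lemma hsymZ_neg xs s : s < 0 -> hsymZ xs s = 0.
Proof. by case: s. Qed.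

Lemma hsym0 xs : hsym xs 0 = 1.
Proof.
by elim: xs => //= x xs IH; rewrite big_ord_recl big_ord0 expr0 IH; ring.
Qed.

Lemma hsymZ0 xs : hsymZ xs 0 = 1.
Proof. exact: hsym0. Qed.

Lemma signed_esym_cons x xs s : signed_esym (x :: xs) s =
  signed_esym xs s - x * signed_esym xs (s - 1).
Proof. by []. Qed.

Lemma signed_esym_lt0 xs s : s < 0 -> signed_esym xs s = 0.
Proof.
rewrite /signed_esym; elim: xs s => [|x xs IH] s s0 /=; first by rewrite /delta; case: eqP =>
  //; lia.
by rewrite !IH ?mulr0 ?subr0 //; lia.
Qed.

Lemma signed_esym_gt xs s : (size xs)%:Z < s -> signed_esym xs s = 0.
Proof.
rewrite /signed_esym; elim: xs s => [|x xs IH] s /= s0; first by rewrite /delta; case: eqP =>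
  //; lia.
by rewrite !IH ?mulr0 ?subr0 //; lia.
Qed.

Lemma signed_esym0 xs : signed_esym xs 0 = 1.
Proof.
rewrite /signed_esym; elim: xs => [|x xs IH] //=.
by rewrite IH -/(signed_esym xs (0 - 1)) signed_esym_lt0 //; ring.
Qed.

(** Both difference operators as convolutions over a finite range of natural
    numbers; the bounds on k, r and Q keep the support of signed_esym inside the
    range. *)
Lemma sum_signed_esym_fdiff xs g (k Q : nat) : (k + size xs < Q)%N ->
  \sum_(q < Q) signed_esym xs (q%:Z - k%:Z) * g q = fdiff xs g k.
Proof.
elim: xs k => [|x xs IH] k kQ; rewrite /= in kQ.
  have kQ' : (k < Q)%N by lia.
  rewrite (bigD1 (Ordinal kQ')) //= big1 => [|q qk].
    by rewrite /signed_esym /= /delta subrr eqxx mul1r addr0.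
  rewrite /signed_esym /= /delta subr_eq0 eqz_nat.
  by move: qk; rewrite -val_eqE /= => /negPf ->; rewrite mul0r.
rewrite fdiff_cons.
have -> : k%:Z + 1 = k.+1 by lia.
rewrite -!IH; try lia.
rewrite mulr_sumr -sumrB; apply: eq_bigr => q _.
rewrite signed_esym_cons.
have -> : q%:Z - k%:Z - 1 = q%:Z - k.+1%:Z by lia.
ring.
Qed.

Lemma sum_signed_esym_bdiff xs g (r Q : nat) : (size xs <= r < Q)%N ->
  \sum_(q < Q) signed_esym xs (r%:Z - q%:Z) * g q = bdiff xs g r.
Proof.
elim: xs r => [|x xs IH] r rQ; rewrite /= in rQ.
  have rQ' : (r < Q)%N by lia.
  rewrite (bigD1 (Ordinal rQ')) //= big1 => [|q qk].
    by rewrite /signed_esym /= /delta subrr eqxx mul1r addr0.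
  rewrite /signed_esym /= /delta subr_eq0 eqz_nat eq_sym.
  by move: qk; rewrite -val_eqE /= => /negPf ->; rewrite mul0r.
have r0 : (0 < r)%N by lia.
rewrite bdiff_cons.
have -> : r%:Z - 1 = r.-1 by lia.
rewrite -!IH; try lia.
rewrite mulr_sumr -sumrB; apply: eq_bigr => q _.
rewrite signed_esym_cons.
have -> : r%:Z - q%:Z - 1 = r.-1%:Z - q%:Z by lia.
ring.
Qed.

Lemma bdiff_neg xs f : (forall s, s < 0 -> f s = 0) ->
  forall s, s < 0 -> bdiff xs f s = 0.
Proof.
move=> f0; elim: xs => [|x xs IH] s s0 /=; first exact: f0.
by rewrite !IH ?mulr0 ?subr0 //; lia.
Qed.

(** Since hsymZ inverts bdiff, a sequence supported on the nonnegative integers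
    is recovered from its difference by convolution. *)
Lemma conv_hsymZ_bdiff xs f (k n : nat) : (forall s, s < 0 -> f s = 0) -> (k < n)%N ->
  f k = \sum_(p < n) bdiff xs f p * hsymZ xs (k%:Z - p%:Z).
Proof.
case: n => // n f0 kn; elim: xs => [|x xs IH].
  rewrite (bigD1 (Ordinal kn)) //= big1 => [|q qk].
    by rewrite subrr mulr1 addr0.
  rewrite hsymZ_nil /delta subr_eq0 eqz_nat eq_sym.
  by move: qk; rewrite -val_eqE /= => /negPf ->; rewrite mulr0.
rewrite IH; set F := bdiff xs f.
have F0 : forall s, s < 0 -> F s = 0 by exact: bdiff_neg.
under eq_bigr do rewrite -(hsymZ_cons x) mulrBr.
under [RHS]eq_bigr do rewrite bdiff_cons -/F mulrBl.
rewrite !sumrB; congr (_ - _).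
rewrite big_ord_recr [RHS]big_ord_recl.
have -> : (@ord0 n : nat)%:Z - 1 = -1 by [].
rewrite (F0 (-1)) // mulr0 mul0r add0r.
rewrite [hsymZ _ (k%:Z - n%:Z - 1)]hsymZ_neg; last by lia.
rewrite !mulr0 [LHS]addr0; apply: eq_bigr => i _.
rewrite lift0.
have -> : i.+1%:Z - 1 = i by lia.
have -> : k%:Z - i.+1%:Z = k%:Z - i%:Z - 1 by lia.
ring.
Qed.

Definition geomZ x (s : int) : R := if s is Posz k then x ^+ k else 0.

Lemma geomZ_rec x s : geomZ x s - x * geomZ x (s - 1) = delta s.
Proof.
case: s => [[|k]|k].
- by rewrite /= mulr0 subr0 expr0.
- have -> : Posz k.+1 - 1 = k by lia.
  by rewrite /= exprS subrr.
- have -> : Negz k - 1 = Negz k.+1 by lia.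
  by rewrite /= mulr0 subr0.
Qed.

Lemma bdiff_geomZ_gt xs x s : x \in xs -> (size xs)%:Z <= s -> bdiff xs (geomZ x) s = 0.
Proof.
elim: xs s => // y xs IH s; rewrite inE => /orP[/eqP <-|xxs] /= ss.
  rewrite -bdiff_headC (eq_bdiff _ (geomZ_rec x)) -/(signed_esym xs s) signed_esym_gt //; lia.
by rewrite !IH // ?mulr0 ?subr0 //; lia.
Qed.

(** If x is one of the variables, then 1 / (1 - x z) is a polynomial of degree
    less than |xs| times the generating series of the complete homogeneous
    functions; this is what turns alternants into Jacobi-Trudi determinants. *)
Lemma expr_conv_hsymZ xs x (k : nat) : x \in xs ->
  x ^+ k = \sum_(p < size xs) bdiff xs (geomZ x) p * hsymZ xs (k%:Z - p%:Z).
Proof.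
move=> xxs.
have := @conv_hsymZ_bdiff xs (geomZ x) k (k.+1 + size xs).
rewrite {1}/geomZ /= => ->; [|by case|lia].
rewrite addnC big_split_ord /= [X in _ + X]big1 ?addr0 // => i _.
by rewrite bdiff_geomZ_gt ?mul0r //; lia.
Qed.

(** The Laurent coefficients of F(xs;z) / F(ys;1/z), and of its inverse. *)
Definition symb_coef xs ys : int -> R := fdiff ys (hsymZ xs).
Definition symb_inv_coef xs ys : int -> R := bdiff xs (fun s => hsymZ ys (- s)).

(** The sum of a_(k-r) b_(r-l) over all r would be delta_kl, because the two
    series are inverse to each other.  Subtracting the terms with r >= N leaves the
    part r < N, written as a finite sum: a_(k-r) vanishes for r > k + |ys|. *)
Definition corr_kernel xs ys (N k l : nat) : R :=
  (k == l)%:R - \sum_(N <= r < (k + size ys).+1)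
     symb_coef xs ys (k%:Z - r%:Z) * symb_inv_coef xs ys (r%:Z - l%:Z).

(** The coordinates of row k of the kernel in the basis h_(l-q)(ys), q < N. *)
Definition kernel_row xs ys (N k : nat) (q : nat) : R :=
  signed_esym ys (q%:Z - k%:Z) - \sum_(N <= r < (k + size ys).+1)
     symb_coef xs ys (k%:Z - r%:Z) * signed_esym xs (r%:Z - q%:Z).

Lemma symb_coef_lt xs ys s : s < - (size ys)%:Z -> symb_coef xs ys s = 0.
Proof.
rewrite /symb_coef; elim: ys s => [|y ys IH] s /= ss; first by rewrite hsymZ_neg //; lia.
by rewrite !IH ?mulr0 ?subr0 //; lia.
Qed.

Lemma symb_coef_ltn xs ys (k r : nat) : (k + size ys < r)%N ->
  symb_coef xs ys (k%:Z - r%:Z) = 0.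
Proof. by move=> kr; apply: symb_coef_lt; lia. Qed.

(** Multiplying F(xs;z) / F(ys;1/z) by the product of the (1 - x z) leaves
    1 / F(ys;1/z), a polynomial in 1/z. *)
Lemma bdiff_symb_coef xs ys s : bdiff xs (symb_coef xs ys) s = signed_esym ys (- s).
Proof.
rewrite bdiff_fdiff (eq_fdiff _ (@bdiff_hsymZ xs)).
rewrite (eq_fdiff _ (g := fun u => delta (0 - u))) => [|u].
  by rewrite fdiff_rev sub0r.
by rewrite /delta sub0r oppr_eq0.
Qed.

(** For q >= N every index r for which signed_esym xs (r - q) is nonzero satisfies
    r >= N, so the sum in kernel_row is complete and cancels the first term. *)
Lemma kernel_row_ge xs ys (N k q : nat) : (size xs <= N)%N -> (size ys <= N)%N ->
  (N <= q)%N -> kernel_row xs ys N k q = 0.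
Proof.
move=> nN mN Nq; rewrite /kernel_row.
set Rb := (k + size ys).+1.
pose g (r : int) := symb_coef xs ys (k%:Z - r).
have E := @sum_signed_esym_fdiff xs g q ((q + size xs).+1 + Rb + N)%N _.
rewrite [X in _ - X](_ : _ = fdiff xs g q).
  rewrite /g fdiff_rev bdiff_symb_coef; apply/eqP; rewrite subr_eq0; apply/eqP.
  by congr (signed_esym _ _); ring.
rewrite -E; last by lia.
rewrite -(big_mkord xpredT (fun r : nat => signed_esym xs (r%:Z - q%:Z) * g r)).
rewrite [RHS](big_cat_nat _ (n := N)) /=; [|lia|lia].
rewrite [X in _ = X + _]big_nat_cond [X in _ = X + _]big1 ?add0r; last first.
  by move=> i /andP[/andP[_ iN] _]; rewrite signed_esym_lt0 ?mul0r //; lia.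
have [NR|NR] := leqP N Rb; last first.
  rewrite big_geq; last by lia.
  rewrite big_nat_cond big1 // => i /andP[/andP[iN _] _].
  by rewrite /g symb_coef_lt ?mulr0 //; lia.
rewrite [RHS](big_cat_nat _ (n := Rb)) /=; [|lia|lia].
rewrite [X in _ = _ + X]big_nat_cond [X in _ = _ + X]big1 ?addr0.
  by apply: eq_bigr => i _; rewrite mulrC.
by move=> i /andP[/andP[iN _] _]; rewrite /g symb_coef_lt ?mulr0 //; lia.
Qed.

(** Because the row vanishes from N on, pairing it with a sequence g may be
    computed on a longer range, where the convolutions become difference
    operators applied to g. *)
Lemma sum_kernel_row xs ys (N k : nat) (g : int -> R) : (size xs <= N)%N -> (size ys <= N)%N ->
  \sum_(q < N) kernel_row xs ys N k q * g q =
  fdiff ys g k - \sum_(N <= r < (k + size ys).+1) symb_coef xs ys (k%:Z - r%:Z) * bdiff xs g r.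
Proof.
move=> nN mN; set Rb := (k + size ys).+1.
have -> : \sum_(q < N) kernel_row xs ys N k q * g q =
          \sum_(q < N + Rb) kernel_row xs ys N k q * g q.
  rewrite big_split_ord /= [X in _ + X]big1 ?addr0 // => i _.
  by rewrite kernel_row_ge ?mul0r //; lia.
rewrite -(@sum_signed_esym_fdiff ys g k (N + Rb)); last by lia.
under eq_bigr do rewrite /kernel_row mulrBl.
rewrite sumrB; congr (_ - _).
under eq_bigr do rewrite mulr_suml.
rewrite exchange_big /= big_nat_cond [RHS]big_nat_cond; apply: eq_bigr => r.
move=> /andP[/andP[Nr rR] _].
rewrite -(@sum_signed_esym_bdiff xs g r (N + Rb)); last by lia.
by rewrite mulr_sumr; apply: eq_bigr => q _; rewrite mulrA.
Qed.

Lemma sum_kernel_row_hsymZ xs ys (N k l : nat) : (size xs <= N)%N -> (size ys <= N)%N ->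
  \sum_(q < N) kernel_row xs ys N k q * hsymZ ys (l%:Z - q%:Z) = corr_kernel xs ys N k l.
Proof.
move=> nN mN; rewrite (@sum_kernel_row xs ys N k (fun q => hsymZ ys (l%:Z - q))) // /corr_kernel.
rewrite fdiff_rev bdiff_hsymZ /delta subr_eq0 eqz_nat eq_sym; congr (_ - _).
apply: eq_bigr => r _; congr (_ * _); rewrite /symb_inv_coef.
rewrite -bdiff_shift; apply: eq_bdiff => s; congr (hsymZ _ _); ring.
Qed.

(** With c the Gram sequence of the two families, this is the reproducing property
    of the kernel on the span of the h_(k-p)(xs).  The sum over r disappears since
    p < N <= r and h_(p-r) = 0. *)
Lemma sum_kernel_row_gram xs ys (c : int -> R) (N k p : nat) :
  (size xs <= N)%N -> (size ys <= N)%N -> (p < N)%N ->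
  (forall s, bdiff ys c s = hsymZ xs (- s)) -> (forall s, fdiff xs c s = hsymZ ys s) ->
  \sum_(q < N) kernel_row xs ys N k q * c (p%:Z - q%:Z) = hsymZ xs (k%:Z - p%:Z).
Proof.
move=> nN mN pN cY cX; rewrite (@sum_kernel_row xs ys N k (fun q => c (p%:Z - q))) //.
rewrite fdiff_rev cY big_nat_cond big1 => [|r /andP[/andP[Nr _] _]].
  by rewrite subr0; congr (hsymZ _ _); ring.
by rewrite bdiff_rev cX hsymZ_neg ?mulr0 //; lia.
Qed.

End Sequences.

(** * The Cauchy identity as a Toeplitz determinant *)

Section Toeplitz.
Variable R : comNzRingType.
Implicit Types (xs ys : seq R) (c : int -> R).

Definition toeplitz c N : 'M[R]_N := \matrix_(p, q) c (p%:Z - q%:Z).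

Lemma fdiff_geomZ xs x s : 0 <= s ->
  fdiff xs (geomZ x) s = \prod_(y <- xs) (1 - x * y) * geomZ x s.
Proof.
elim: xs s => [|y ys IH] s s0; first by rewrite big_nil mul1r.
rewrite fdiff_cons big_cons !IH; [|lia|lia].
have -> : geomZ x (s + 1) = x * geomZ x s.
  case: s s0 => // k _; have -> : k%:Z + 1 = k.+1 by lia.
  by rewrite /= exprS.
ring.
Qed.

Lemma det_row_delta N (A : 'M[R]_N.+1) i j :
  (forall k, A i k = (k == j)%:R) -> \det A = cofactor A i j.
Proof.
move=> Ai; rewrite (expand_det_row A i) (bigD1 j) //= big1 => [|k kj].
  by rewrite Ai eqxx mul1r addr0.
by rewrite Ai (negPf kj) mul0r.
Qed.

(** The matrix W combines the rows of the Toeplitz matrix of c'.  Its first N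
    rows, bidiagonal, remove the factor 1 - x / z and produce the rows of the
    Toeplitz matrix of c; its last row, the coefficients of the product of the
    (1 - y z), produces a unit vector.  Expanding along that row
    leaves the Toeplitz matrix of c of size N, so everything rests on the
    determinant of W. *)
Lemma det_toeplitz_step xs ys x c c' N : (size ys <= N)%N ->
  (forall s, c' s - x * c' (s + 1) = c s) ->
  (forall s, 0 <= s -> bdiff ys c' s = delta R s) ->
  \prod_(y <- ys) (1 - x * y) * \det (toeplitz c' N.+1) = \det (toeplitz c N).
Proof.
move=> mN cc' c'Y.
pose W : 'M[R]_N.+1 := \matrix_(p, q)
  if (p < N)%N then (p == q :> nat)%:R - x * (p.+1 == q :> nat)%:R
  else signed_esym ys (N%:Z - q%:Z).
pose V : 'M[R]_N.+1 := \matrix_(p, q)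
  if (q < N)%N then (p == q :> nat)%:R else geomZ x (N%:Z - p%:Z).
have lastN (p : 'I_N.+1) : (p < N)%N = false -> p = ord_max.
  by move=> pN; apply/val_inj => /=; have := ltn_ord p; lia.
have sumW (f : int -> R) (p : 'I_N.+1) : (p < N)%N ->
    \sum_q W p q * f (q : nat)%:Z = f (p : nat)%:Z - x * f (p.+1)%:Z.
  move=> pN.
  have pN1 : (p.+1 < N.+1)%N by [].
  rewrite (eq_bigr (fun q : 'I_N.+1 => (q == p)%:R * f q%:Z
      - x * ((q == Ordinal pN1)%:R * f q%:Z))) => [|q _]; last first.
    rewrite mxE pN -!val_eqE /= ![_ == nat_of_ord q]eq_sym; ring.
  rewrite sumrB -mulr_sumr (bigD1 p) //= eqxx mul1r big1 => [|q /negPf ->]; last by rewrite mul0r.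
  rewrite (bigD1 (Ordinal pN1)) //= eqxx mul1r big1 => [|q /negPf ->]; last by rewrite mul0r.
  by rewrite !addr0.
have sumWmax (f : int -> R) : \sum_q W ord_max q * f (q : nat)%:Z = bdiff ys f N.
  rewrite -(@sum_signed_esym_bdiff _ ys f N N.+1); last by lia.
  by apply: eq_bigr => q _; rewrite mxE /= ltnn.
(* V is the identity with its last column replaced by the powers of x, which the
   bidiagonal rows of W annihilate; W *m V then has a single nonzero entry in its
   last column, the product of the (1 - x y). *)
have detV : \det V = 1.
  rewrite -det_tr det_trig.
    apply: big1 => i _; rewrite !mxE eqxx; case: ifPn => // /negPf/lastN -> /=.
    by rewrite subrr.
  apply/is_trig_mxP => i j ij; rewrite !mxE.
  have jN := ltn_ord j.
  have -> : (i < N)%N by lia.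
  by case: eqP => //; lia.
have detW : \det W = \prod_(y <- ys) (1 - x * y).
  have -> : \det W = \det (W *m V)^T by rewrite det_tr det_mulmx detV mulr1.
  have WVlast p : (W *m V) p ord_max = if (p < N)%N then 0 else \prod_(y <- ys) (1 - x * y).
    rewrite mxE (eq_bigr (fun q : 'I_N.+1 => W p q * geomZ x (N%:Z - q%:Z))); last first.
      by move=> q _; rewrite [V _ _]mxE /= ltnn.
    case: ifPn => [pN|/negPf/lastN ->].
      rewrite (sumW (fun q => geomZ x (N%:Z - q))) //.
      have -> : N%:Z - p%:Z = (N - p.+1).+1 by lia.
      have -> : N%:Z - p.+1%:Z = (N - p.+1)%N by lia.
      by rewrite /= exprS subrr.
    rewrite (sumWmax (fun q => geomZ x (N%:Z - q))) bdiff_rev subrr fdiff_geomZ //=.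
    by rewrite expr0 mulr1.
  rewrite (expand_det_row _ ord_max) (bigD1 ord_max) //= big1 => [|k kj]; last first.
    rewrite mxE WVlast; case: ifPn => [_|/negPf/lastN kE]; first by rewrite mul0r.
    by rewrite kE eqxx in kj.
  rewrite mxE WVlast ltnn addr0 /cofactor -signr_odd oddD addbb expr0 mul1r.
  rewrite det_trig.
    rewrite [\prod_(i < _) _]big1 ?mulr1 // => i _; rewrite !mxE.
    rewrite (eq_bigr (fun q : 'I_N.+1 => W (lift ord_max i) q * (q%:Z == i%:Z)%:R)).
      rewrite (sumW (fun q => (q == i%:Z)%:R)) lift_max ?ltn_ord // eqxx.
      by rewrite eqz_nat gtn_eqF // mulr0 subr0.
    by move=> q _; rewrite [V _ _]mxE lift_max ltn_ord.
  apply/is_trig_mxP => i j ij; rewrite !mxE.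
  rewrite (eq_bigr (fun q : 'I_N.+1 => W (lift ord_max j) q * (q%:Z == i%:Z)%:R)).
    rewrite (sumW (fun q => (q == i%:Z)%:R)) lift_max ?ltn_ord //.
    by rewrite !eqz_nat !gtn_eqF /= ?mulr0 ?subr0 //; exact: ltnW.
  by move=> q _; rewrite [V _ _]mxE lift_max ltn_ord.
rewrite -detW -det_mulmx.
have WG p q : (W *m toeplitz c' N.+1) p q =
    if (p < N)%N then c (p%:Z - q%:Z) else (q == ord_max)%:R.
  rewrite mxE (eq_bigr (fun r : 'I_N.+1 => W p r * c' (r%:Z - q%:Z))); last first.
    by move=> r _; rewrite [toeplitz _ _ _ _]mxE.
  case: ifPn => [pN|/negPf/lastN ->].
    rewrite (sumW (fun r => c' (r - q%:Z))) // -cc'.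
    by congr (_ - _ * c' _); lia.
  rewrite (sumWmax (fun r => c' (r - q%:Z))) bdiff_shift c'Y.
    rewrite /delta subr_eq0 eqz_nat -val_eqE /=; congr ((_)%:R); congr nat_of_bool; exact: eq_sym.
  by have := ltn_ord q; lia.
rewrite (@det_row_delta _ _ ord_max ord_max) => [|k]; last by rewrite WG /= ltnn.
rewrite /cofactor -signr_odd oddD addbb expr0 mul1r; congr (\det _).
by apply/matrixP => i j; rewrite [LHS]mxE [LHS]mxE WG !lift_max ltn_ord [RHS]mxE.
Qed.

(** The two hypotheses characterize the Laurent coefficients c of
    F(ys;z) F(xs;1/z), and removing a variable from xs preserves them.  When xs is
    empty the matrix is triangular with unit diagonal. *)
Theorem det_toeplitz xs ys c N : (size xs + size ys <= N)%N ->
  (forall s, bdiff ys c s = hsymZ xs (- s)) -> (forall s, fdiff xs c s = hsymZ ys s) ->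
  (\prod_(x <- xs) \prod_(y <- ys) (1 - x * y)) * \det (toeplitz c N) = 1.
Proof.
elim: xs c N => [|x xs IH] c N szN cY cX.
  rewrite big_nil mul1r det_trig; last first.
    by apply/is_trig_mxP => i j ij; rewrite mxE -[c _]/(fdiff [::] c _) cX hsymZ_neg //; lia.
  by apply: big1 => i _; rewrite mxE -[c _]/(fdiff [::] c _) cX subrr hsymZ0.
case: N szN => // N szN; rewrite big_cons mulrC mulrA mulrC.
rewrite [_ * \prod_(y <- ys) _]mulrC.
pose d s := c s - x * c (s + 1).
rewrite (@det_toeplitz_step xs ys x d) //.
- apply: IH => [|s|s]; first by rewrite /= in szN; lia.
  + rewrite /d bdiff_lin bdiff_shift !cY -[RHS](hsymZ_cons x).
    by congr (_ - _ * hsymZ _ _); rewrite opprD.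
  + by rewrite /d fdiff_lin fdiff_shift -fdiff_cons cX.
- by rewrite /= in szN; lia.
- move=> s s0; rewrite cY; case: s s0 => [[|s]|s] s0 //.
  by rewrite oppr0 hsymZ0.
Qed.
End Toeplitz.

(** * The Cauchy-Binet formula *)

Section CauchyBinet.
Variable R : comNzRingType.

Definition incr N M (f : {ffun 'I_N -> 'I_M}) : bool :=
  [forall i : 'I_N, forall j : 'I_N, (i < j)%N ==> (f i < f j)%N].

Lemma incrP N M (f : {ffun 'I_N -> 'I_M}) :
  reflect (forall i j : 'I_N, (i < j)%N -> (f i < f j)%N) (incr f).
Proof.
apply: (iffP forallP) => H i; last by apply/forallP => j; apply/implyP; apply: H.
by move=> j; move/forallP: (H i) => /(_ j)/implyP.
Qed.

Lemma incr_inj N M (f : {ffun 'I_N -> 'I_M}) : incr f -> injective f.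
Proof.
move=> /incrP incf i j fij; apply/val_inj/eqP; rewrite /= eqn_leq.
apply/andP; split; rewrite leqNgt; apply/negP => /incf; rewrite fij ltnn //.
Qed.

Definition ltord M : rel 'I_M := fun i j => (i < j)%N.

Lemma ltord_sorted_enum M (A : {pred 'I_M}) : sorted (@ltord M) (enum A).
Proof.
have tr : transitive (@ltord M) by move=> a b c; exact: ltn_trans.
rewrite /enum_mem -enumT; apply: sorted_filter => //.
rewrite -(@sorted_map _ _ val ltn) val_enum_ord; exact: iota_ltn_sorted.
Qed.

Lemma incr_enum_image N M (f : {ffun 'I_N -> 'I_M}) : incr f ->
  [seq f i | i <- enum 'I_N] = enum (f @: 'I_N).
Proof.
move=> incf; apply: (@irr_sorted_eq _ (@ltord M)).
- by move=> a b c; exact: ltn_trans.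
- by move=> a; exact: ltnn.
- rewrite sorted_map; apply: sub_sorted (@ltord_sorted_enum N _) => i j.
  exact: (incrP f incf).
- exact: ltord_sorted_enum.
move=> x; rewrite mem_enum; apply/mapP/imsetP => -[i _ ->]; exists i => //.
by rewrite mem_enum.
Qed.

(** An increasing function is the increasing enumeration of its image. *)
Lemma incr_image_inj N M (f g : {ffun 'I_N -> 'I_M}) : incr f -> incr g ->
  f @: 'I_N = g @: 'I_N -> f = g.
Proof.
move=> incf incg fg; apply/ffunP => i.
have := incr_enum_image incf; rewrite fg -(incr_enum_image incg).
by move/eq_in_map; apply; rewrite mem_enum.
Qed.

Lemma incr_of_set N M (A : {set 'I_M}) : #|A| = N ->
  exists2 f : {ffun 'I_N -> 'I_M}, incr f & f @: 'I_N = A.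
Proof.
move=> cA.
exists [ffun i : 'I_N => enum_val (cast_ord (esym cA) i)].
  apply/incrP => i j ij; rewrite !ffunE.
  have szA : size (enum A) = N by rewrite -cardE.
  rewrite (enum_val_nth (enum_val (cast_ord (esym cA) i))).
  rewrite [in X in (_ < X)%N](enum_val_nth (enum_val (cast_ord (esym cA) i))) /=.
  have tr : transitive (@ltord M) by move=> a b c; exact: ltn_trans.
  apply: (@sorted_ltn_nth _ (@ltord M) tr _ _ (@ltord_sorted_enum M A)) => //.
    by rewrite inE szA.
  by rewrite inE szA.
set f := [ffun _ => _]; apply/eqP; rewrite eqEcard; apply/andP; split.
  by apply/fintype.subsetP => x /imsetP[i _ ->]; rewrite ffunE; exact: enum_valP.
rewrite card_imset ?card_ord ?cA // => i j; rewrite !ffunE => /enum_val_inj.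
exact: cast_ord_inj.
Qed.

(** The terms of this expansion with f not injective vanish, but they are kept
    here so that the sum ranges over a whole function type. *)
Lemma det_mulmx_ffun N M (A : 'M[R]_(N, M)) (B : 'M[R]_(M, N)) :
  \det (A *m B) = \sum_(f : {ffun 'I_N -> 'I_M})
     (\prod_i A i (f i)) * \det (rowsub f B).
Proof.
rewrite /determinant.
under eq_bigr do under eq_bigr do rewrite mxE.
under eq_bigr do rewrite bigA_distr_bigA /= mulr_sumr.
rewrite exchange_big /=; apply: eq_bigr => f _.
rewrite mulr_sumr; apply: eq_bigr => s _.
rewrite big_split /= mulrCA; congr (_ * (_ * _)).
by apply: eq_bigr => i _; rewrite mxE.
Qed.

(** An injective function is an increasing one composed with a permutation; for a
    fixed increasing function the sum over the permutations rebuilds the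
    determinant of the selected columns of A. *)
Theorem cauchy_binet N M (A : 'M[R]_(N, M)) (B : 'M[R]_(M, N)) :
  \det (A *m B) = \sum_(f : {ffun 'I_N -> 'I_M} | incr f)
     \det (colsub f A) * \det (rowsub f B).
Proof.
rewrite det_mulmx_ffun (bigID (fun f : {ffun 'I_N -> 'I_M} => injectiveb f)) /=.
rewrite [X in _ + X]big1 ?addr0; last first.
  move=> f /injectivePn[i [j ij fij]].
  rewrite [\det _](determinant_alternate ij) ?mulr0 // => k.
  by rewrite !mxE fij.
have H (f : {ffun 'I_N -> 'I_M}) : exists g : {ffun 'I_N -> 'I_M},
    injectiveb f ==> incr g && (g @: 'I_N == f @: 'I_N).
  case: (boolP (injectiveb f)) => [/injectiveP finj|]; last by exists f.
  have [|g incg gf] := @incr_of_set N M (f @: 'I_N).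
    by rewrite card_imset // card_ord.
  by exists g; rewrite incg gf eqxx.
(* The increasing function with the same image, when f is injective. *)
pose srt f := xchoose (H f).
have srtP (f : {ffun 'I_N -> 'I_M}) : injectiveb f -> incr (srt f) /\ srt f @: 'I_N = f @: 'I_N.
  by move=> finj; have /implyP/(_ finj)/andP[? /eqP] := xchooseP (H f).
rewrite (partition_big srt (fun g => incr g)) /=; last first.
  by move=> f /srtP[].
apply: eq_bigr => g incg.
have ginj := incr_inj incg.
pose h := fun s : 'S_N => [ffun i => g (s i)] : {ffun 'I_N -> 'I_M}.
have hE (s : 'S_N) i : h s i = g (s i) by rewrite ffunE.
have hinj : injective h.
  move=> s t /ffunP st; apply/permP => i; apply: ginj.
  by have := st i; rewrite !ffunE.
transitivity (\sum_(f in h @: [set: 'S_N]%SET) (\prod_i A i (f i)) * \det (rowsub f B)).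
  apply: eq_bigl => f; apply/idP/imsetP => [/andP[finj /eqP sg]|[s _ ->]].
    have [_ gf] := srtP f finj; rewrite sg in gf.
    have fg i : f i \in g @: 'I_N by rewrite gf imset_f.
    pose q i := if [pick j | g j == f i] is Some j then j else i.
    have gq i : g (q i) = f i.
      rewrite /q; case: pickP => [j /eqP //|].
      by have /imsetP[j _ ->] := fg i => /(_ j); rewrite eqxx.
    have qinj : injective q.
      move=> i j /(congr1 g); rewrite !gq; exact/injectiveP.
    exists (perm qinj) => //; apply/ffunP => i; rewrite ffunE permE gq //.
  have hsinj : injectiveb (h s).
    by apply/injectiveP => i j; rewrite !ffunE => /ginj /perm_inj.
  rewrite hsinj /=; have [incs eqs] := srtP _ hsinj.
  apply/eqP; apply: incr_image_inj => //; rewrite eqs.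
  apply/setP => x; apply/imsetP/imsetP => -[i _ ->]; first by exists (s i); rewrite ?ffunE.
  by exists (s^-1%g i) => //; rewrite ffunE permKV.
rewrite big_imset /=; last by move=> s t _ _; exact: hinj.
rewrite -[\det (colsub g A)]det_tr /determinant mulr_suml.
rewrite (eq_bigl xpredT) => [|s]; last by rewrite inE.
rewrite (reindex_inj invg_inj) /=; apply: eq_bigr => s _.
rewrite -/(determinant _) -/(determinant (rowsub g B)).
have -> : \det (rowsub (h (s^-1)%g) B) = (-1) ^+ s * \det (rowsub g B).
  rewrite -[s in RHS]invgK odd_permV -det_perm -det_mulmx; congr (\det _).
  rewrite -row_permE; apply/matrixP => i j; rewrite !mxE ffunE //.
rewrite mulrCA mulrA; congr (_ * _ * _).
rewrite (reindex_inj (@perm_inj _ s)) /=; apply: eq_bigr => i _.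
by rewrite !mxE ffunE permK.
Qed.
End CauchyBinet.

(** * The Jacobi-Trudi formula *)

Section JacobiTrudi.
Variable K : fieldType.
Implicit Types (xs : seq K) (lam : nat -> nat).

Definition jacobi_trudi xs N lam : K :=
  \det (\matrix_(i < N, j < N) hsymZ xs ((lam j)%:Z + i%:Z - j%:Z)).

(** A zero part makes the last column a unit vector. *)
Lemma jacobi_trudiS xs N lam : lam N = 0%N -> jacobi_trudi xs N.+1 lam = jacobi_trudi xs N lam.
Proof.
move=> lamN; rewrite /jacobi_trudi -det_tr (@det_row_delta _ _ _ ord_max ord_max) => [|k].
  rewrite /cofactor -signr_odd oddD addbb expr0 mul1r -det_tr; congr (\det _).
  by apply/matrixP => i j; rewrite !mxE !lift_max.
rewrite !mxE lamN add0r -val_eqE /=; have := ltn_ord k.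
rewrite ltnS leq_eqVlt => /orP[/eqP ->|kN]; first by rewrite subrr hsymZ0 eqxx.
by rewrite ltn_eqF // hsymZ_neg //; lia.
Qed.

Lemma jacobi_trudi_widen xs n N lam : (n <= N)%N ->
  (forall k, (n <= k)%N -> lam k = 0%N) -> jacobi_trudi xs N lam = jacobi_trudi xs n lam.
Proof.
move=> nN lam0; rewrite -(subnKC nN); elim: (N - n)%N => [|m IH]; first by rewrite addn0.
by rewrite addnS jacobi_trudiS // lam0 // leq_addr.
Qed.

(** The complete homogeneous functions h_k of n variables satisfy a linear recurrence
    of order n for k > 0, so more than n consecutive rows are linearly dependent;
    positive parts keep the leading index of the recurrence positive. *)
Lemma jacobi_trudi_eq0 xs N lam : (size xs < N)%N ->
  (forall j, (j < N)%N -> (0 < lam j)%N) -> jacobi_trudi xs N lam = 0.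
Proof.
case: N => // N nN lam0; apply/eqP/det0P.
(* The recurrence, read from the last row upwards; its leading coefficient is 1. *)
exists (\row_i signed_esym xs (N%:Z - i%:Z)).
  apply/eqP => /rowP/(_ ord_max); rewrite !mxE subrr signed_esym0.
  exact/eqP/oner_neq0.
apply/rowP => j; rewrite !mxE.
under eq_bigr do rewrite !mxE.
pose g i := hsymZ xs (i + ((lam j)%:Z - j%:Z)).
transitivity (\sum_(i < N.+1) signed_esym xs (N%:Z - i%:Z) * g i).
  by apply: eq_bigr => i _; congr (_ * hsymZ _ _); lia.
rewrite sum_signed_esym_bdiff; last by rewrite ltnSn andbT.
rewrite bdiff_shift bdiff_hsymZ /delta.
by case: eqP => // H; have := lam0 j (ltn_ord j); have := ltn_ord j; lia.
Qed.

Definition alternant xs lam : K :=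
  \det (\matrix_(i < size xs, j < size xs) (nth 0 xs i ^+ (lam j + (size xs - j.+1)))).

(** Both alternants factor through the same matrix A of coordinates of the powers
    of the x_i in the complete homogeneous functions; for the empty partition the
    other factor is triangular with unit diagonal. *)
Lemma alternant_jacobi_trudi xs lam :
  alternant xs lam = alternant xs (fun=> 0%N) * jacobi_trudi xs (size xs) lam.
Proof.
set n := size xs.
(* The rows of the Jacobi-Trudi determinant run in the order opposite to the
   coordinates, whence n - p - 1. *)
pose A : 'M[K]_n := \matrix_(i, p) bdiff xs (geomZ (nth 0 xs i)) (n%:Z - p.+1%:Z).
have altE mu : alternant xs mu = \det A * jacobi_trudi xs n mu.
  rewrite /alternant /jacobi_trudi -det_mulmx; congr (\det _); apply/matrixP => i j.
  rewrite !mxE (@expr_conv_hsymZ _ xs); last by rewrite mem_nth.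
  rewrite (reindex_inj rev_ord_inj) /=; apply: eq_bigr => p _.
  rewrite !mxE -/n; congr (bdiff _ _ _ * hsymZ _ _).
    by have := ltn_ord p; rewrite /= -/n; lia.
  by have := ltn_ord p; have := ltn_ord j; rewrite /= -/n; lia.
rewrite !altE; congr (_ * _); rewrite [X in _ * X](_ : _ = 1) ?mulr1 //.
rewrite /jacobi_trudi det_trig; first by apply: big1 => i _; rewrite mxE add0r subrr hsymZ0.
by apply/is_trig_mxP => i j ij; rewrite mxE hsymZ_neg //; lia.
Qed.

Lemma det_rev N (A : 'M[K]_N) : \det (\matrix_(i, j) A (rev_ord i) (rev_ord j)) = \det A.
Proof.
pose s := perm (@rev_ord_inj N).
have -> : \matrix_(i, j) A (rev_ord i) (rev_ord j) = row_perm s (col_perm s A).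
  by apply/matrixP => i j; rewrite !mxE !permE.
rewrite row_permE col_permE !det_mulmx !det_perm odd_permV.
by rewrite mulrCA -expr2 sqrr_sign mulr1.
Qed.

(** Up to transposition and reversal of the rows this is the Vandermonde matrix. *)
Lemma alternant0_neq0 xs : uniq xs -> alternant xs (fun=> 0%N) != 0.
Proof.
move=> uxs; rewrite /alternant -det_tr; set n := size xs.
pose a := \row_(i < n) nth 0 xs i.
have -> : (\matrix_(i < n, j < n) (nth 0 xs i ^+ (0 + (n - j.+1))))^T =
   row_perm (perm (@rev_ord_inj n)) (Vandermonde n a).
  by apply/matrixP => i j; rewrite !mxE permE /= add0n.
rewrite row_permE det_mulmx det_perm mulf_neq0 ?signr_eq0 // det_Vandermonde.
apply/prodf_neq0 => i _; apply/prodf_neq0 => j ij; rewrite !mxE subr_eq0.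
by rewrite nth_uniq // neq_ltn ij orbT.
Qed.

(** The number N of rows is free above the lengths of lam and xs: both Schur
    factors must be written with the same number of rows, although X and Y need
    not have the same cardinality. *)
Theorem schur_jacobi_trudi xs (lam : seq nat) N : uniq xs -> 0%N \notin lam ->
  (size xs <= N)%N -> (size lam <= N)%N -> schur xs lam = jacobi_trudi xs N (nth 0%N lam).
Proof.
move=> uxs lam0 nN lN; rewrite /schur; case: ifPn => sl.
  rewrite (@jacobi_trudi_widen _ (size xs) N) //; last first.
    by move=> k kn; rewrite nth_default // (leq_trans sl).
  have -> : \matrix_(i < size xs, j < size xs) (nth 0 xs i ^+ (size xs - j.+1)) =
     \matrix_(i < size xs, j < size xs) (nth 0 xs i ^+ (0 + (size xs - j.+1))).
    by [].
  rewrite -/(alternant xs (fun=> 0%N)) -/(alternant xs (nth 0%N lam)).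
  by rewrite alternant_jacobi_trudi mulrC mulKf // alternant0_neq0.
rewrite (@jacobi_trudi_widen _ (size lam) N) //; last by move=> k kl; rewrite nth_default.
rewrite jacobi_trudi_eq0 // ?ltnNge // => j jl; rewrite lt0n; apply: contra lam0 => /eqP <-.
exact: mem_nth.
Qed.

End JacobiTrudi.

(** * Total positivity of the complete homogeneous functions *)

Section Positivity.
Variable K : realFieldType.
Implicit Types (xs : seq K) (x : K).

Lemma hsymZ_single x s : hsymZ [:: x] s = geomZ x s.
Proof.
case: s => // k; elim: k => [|k IH]; first by rewrite hsymZ0 /= expr0.
have := hsymZ_cons x [::] k.+1; have -> : k.+1%:Z - 1 = k by lia.
by rewrite IH hsymZ_nil /delta /= => /eqP; rewrite subr_eq add0r -exprS => /eqP.
Qed.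

(** If g 0 < f 0, the first column is zero.  If f 0 <= g 0 and another f i is also
    at most g 0, rows 0 and i are proportional on all the columns.  Otherwise the
    first column has a single nonzero entry, and the statement follows by
    induction. *)
Lemma det_geom_ge0 x N (f g : 'I_N -> nat) : 0 <= x ->
  (forall i j : 'I_N, (i < j)%N -> (f i < f j)%N) ->
  (forall i j : 'I_N, (i < j)%N -> (g i < g j)%N) ->
  0 <= \det (\matrix_(i, j) geomZ x ((g j)%:Z - (f i)%:Z)).
Proof.
move=> x0; elim: N f g => [|N IH] f g incf incg; first by rewrite det_mx00.
set A := \matrix_(i, j) _.
have geom0 a b : (b < a)%N -> geomZ x (b%:Z - a%:Z) = 0.
  by move=> ba; have -> : b%:Z - a%:Z = Negz (a - b).-1 by lia.
have geomE a b : (a <= b)%N -> geomZ x (b%:Z - a%:Z) = x ^+ (b - a).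
  by move=> ba; have -> : b%:Z - a%:Z = (b - a)%N by lia.
have mono (h : 'I_N.+1 -> nat) : (forall i j : 'I_N.+1, (i < j)%N -> (h i < h j)%N) ->
    forall i j : 'I_N.+1, (i <= j)%N -> (h i <= h j)%N.
  move=> inch i j; rewrite leq_eqVlt => /orP[/eqP/val_inj -> //|/inch/ltnW //].
have [fg|gf] := leqP (f ord0) (g ord0); last first.
  rewrite (expand_det_col _ ord0) big1 // => i _; rewrite mxE geom0 ?mul0r //.
  by apply: leq_trans gf _; apply: mono.
have [/existsP[i /andP[i0 fi]]|/existsPn nofi] :=
    boolP [exists i : 'I_N.+1, (0 < i)%N && (f i <= g ord0)%N].
  rewrite (_ : \det A = 0) //; apply/eqP/det0P.
  exists (delta_mx 0 ord0 - x ^+ (f i - f ord0) *: delta_mx 0 i).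
    apply/eqP => /rowP/(_ ord0); rewrite !mxE !eqxx /=.
    have -> : (ord0 == i) = false by rewrite -val_eqE /= ltn_eqF.
    by rewrite mulr0 subr0 => /eqP; rewrite oner_eq0.
  rewrite mulmxBl -scalemxAl -!rowE; apply/rowP => j; rewrite !mxE.
  have gj : (g ord0 <= g j)%N by apply: mono.
  have fi0 : (f ord0 < f i)%N by apply: incf.
  rewrite !geomE ?(leq_trans fi) ?(leq_trans fg) // -exprD.
  by apply/eqP; rewrite subr_eq0; apply/eqP; congr (_ ^+ _); lia.
rewrite (expand_det_col _ ord0) (bigD1 ord0) //= big1 => [|i i0]; last first.
  rewrite mxE geom0 ?mul0r // ltnNge.
  have := nofi i; rewrite negb_and => /orP[|//].
  by move: i0; rewrite -val_eqE /= lt0n => ->.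
rewrite addr0 mxE geomE // /cofactor expr0 mul1r mulr_ge0 ?exprn_ge0 //.
have -> : row' ord0 (col' ord0 A) =
  \matrix_(i, j) geomZ x ((g (lift ord0 j))%:Z - (f (lift ord0 i))%:Z).
  by apply/matrixP => i j; rewrite !mxE.
by apply: IH => i j ij; [apply: incf|apply: incg]; rewrite !lift0.
Qed.

Lemma hsymZ_cons_conv x xs (M : nat) (p k : nat) : (k < M)%N ->
  hsymZ (x :: xs) (k%:Z - p%:Z) =
  \sum_(l < M) hsymZ xs (l%:Z - p%:Z) * geomZ x (k%:Z - l%:Z).
Proof.
move=> kM; have := @conv_hsymZ_bdiff _ [:: x] (fun s => hsymZ (x :: xs) (s - p%:Z)) k M.
move=> -> //; last by move=> s s0; rewrite hsymZ_neg //; lia.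
apply: eq_bigr => l _; rewrite hsymZ_single /=; congr (_ * _).
rewrite -(hsymZ_cons x xs); congr (_ - _ * hsymZ _ _); ring.
Qed.

(** Adding a variable multiplies the matrix of the h_(l-p) by the matrix of the
    powers of that variable, and Cauchy-Binet writes a minor of the product as
    a sum of products of minors. *)
Theorem det_hsymZ_ge0 xs N M (f g : {ffun 'I_N -> 'I_M}) :
  (forall x, x \in xs -> 0 <= x) -> incr f -> incr g ->
  0 <= \det (\matrix_(i, j) hsymZ xs ((g j)%:Z - (f i)%:Z)).
Proof.
elim: xs g => [|x xs IH] g xs0 incf incg.
  have -> : \matrix_(i, j) hsymZ [::] ((g j)%:Z - (f i)%:Z) =
            \matrix_(i, j) geomZ (0 : K) ((g j)%:Z - (f i)%:Z).
    apply/matrixP => i j; rewrite !mxE; case: (_ - _) => // k /=.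
    by rewrite expr0n.
  by apply: det_geom_ge0 => // i j ij; [exact: (incrP f incf)|exact: (incrP g incg)].
have -> : \matrix_(i, j) hsymZ (x :: xs) ((g j)%:Z - (f i)%:Z) =
    (\matrix_(i < N, l < M) hsymZ xs (l%:Z - (f i)%:Z)) *m
    (\matrix_(l < M, j < N) geomZ x ((g j)%:Z - l%:Z)).
  apply/matrixP => i j; rewrite !mxE (@hsymZ_cons_conv _ _ M) //.
  by apply: eq_bigr => l _; rewrite !mxE.
rewrite cauchy_binet; apply: sumr_ge0 => h inch; apply: mulr_ge0.
  have -> : colsub h (\matrix_(i < N, l < M) hsymZ xs (l%:Z - (f i)%:Z)) =
    \matrix_(i, j) hsymZ xs ((h j)%:Z - (f i)%:Z) by apply/matrixP => i j; rewrite !mxE.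
  by apply: IH => // y yxs; apply: xs0; rewrite inE yxs orbT.
have -> : rowsub h (\matrix_(l < M, j < N) geomZ x ((g j)%:Z - l%:Z)) =
    \matrix_(i, j) geomZ x ((g j)%:Z - (h i)%:Z) by apply/matrixP => i j; rewrite !mxE.
apply: det_geom_ge0; first by apply: xs0; rewrite mem_head.
  exact: (incrP h inch).
exact: (incrP g incg).
Qed.
End Positivity.

(** * Sums of minors containing prescribed columns *)

Section FiniteCorrelation.
Variable K : fieldType.

(** The two factorizations of one block matrix, into a lower times an upper and an
    upper times a lower block triangular matrix, give the two sides. *)
Lemma det_add1_mulC N d (U : 'M[{poly K}]_(N, d)) (V : 'M[{poly K}]_(d, N)) :
  \det (1%:M + U *m V) = \det (1%:M + V *m U).
Proof.
have E1 : block_mx 1%:M (- U) V 1%:M =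
    block_mx 1%:M 0 V 1%:M *m block_mx 1%:M (- U) 0 (1%:M + V *m U).
  rewrite mulmx_block !mul1mx !mulmx1 !mulmx0 !mul0mx !addr0 mulmxN.
  by rewrite addrCA addNr addr0.
have E2 : block_mx 1%:M (- U) V 1%:M =
    block_mx (1%:M + U *m V) (- U) 0 1%:M *m block_mx 1%:M 0 V 1%:M.
  rewrite mulmx_block ?mul1mx ?mulmx1 ?mulmx0 ?mul0mx ?addr0 ?add0r mulNmx.
  by rewrite addrK.
have := congr1 determinant E1; rewrite E2 !det_mulmx !det_ublock !det_lblock.
by rewrite !det1 !mulr1 !mul1r.
Qed.

Lemma coef_prod_linear d (a b : 'I_d -> K) :
  (size (\prod_i ((a i)%:P + (b i)%:P * 'X))%R <= d.+1)%N /\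
  (\prod_i ((a i)%:P + (b i)%:P * 'X))`_d = \prod_i b i.
Proof.
elim: d a b => [|d IH] a b; first by rewrite !big_ord0 size_poly1 coef1.
rewrite !big_ord_recr /=.
have [szP cP] := IH (fun i => a (widen_ord (leqnSn d) i)) (fun i => b (widen_ord (leqnSn d) i)).
set P := \prod_i _ in szP cP *.
rewrite mulrDr mulrA; split.
  apply: (leq_trans (size_polyD _ _)); rewrite geq_max; apply/andP; split.
    rewrite mulrC mul_polyC (leq_trans (size_scale_leq _ _)) // (leq_trans szP) //.
  apply: (leq_trans (size_polyMleq _ _)); rewrite size_polyX addn2 /= ltnS.
  by rewrite mulrC mul_polyC (leq_trans (size_scale_leq _ _)).
rewrite coefD coefMX /= !coefMC cP [P`_d.+1]nth_default // mul0r add0r //.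
Qed.

Lemma coef_det_linear d (A B : 'M[K]_d) :
  (\det (map_mx polyC A + 'X *: map_mx polyC B))`_d = \det B.
Proof.
rewrite /determinant coef_sum; apply: eq_bigr => s _.
rewrite -(proj2 (coef_prod_linear (fun i => A i (s i)) (fun i => B i (s i)))).
have -> : \prod_i (map_mx polyC A + 'X *: map_mx polyC B) i (s i) =
    \prod_i ((A i (s i))%:P + (B i (s i))%:P * 'X).
  by apply: eq_bigr => i _; rewrite !mxE mulrC.
by rewrite !mulr_sign; case: (odd_perm s) => //=; rewrite coefN.
Qed.

(** With G a Gram matrix and H its part carried by the marked columns, this is
    the Gram determinant after giving the weight 'X to the marked columns. *)
Definition tilted_det N (G H : 'M[K]_N) : {poly K} :=
  \det (map_mx polyC G + ('X - 1) *: map_mx polyC H).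

(** After factoring out G, the determinant of size N reduces to one of size d, whose
    entries have degree at most one in 'X; the coefficient of top degree keeps
    only the linear terms. *)
Lemma coef_tilted_det N d (G : 'M[K]_N) (B : 'M[K]_(d, N)) (P : 'M[K]_(N, d)) :
  (tilted_det G (G *m B^T *m P^T))`_d = \det G * \det (B *m P).
Proof.
rewrite /tilted_det !map_mxM -!mulmxA.
set G' := map_mx polyC G; set U := map_mx polyC B^T; set V := map_mx polyC P^T.
have -> : G' + ('X - 1) *: (G' *m (U *m V)) = G' *m (1%:M + (('X - 1) *: U) *m V).
  by rewrite mulmxDr mulmx1 -scalemxAl -scalemxAr.
rewrite det_mulmx det_map_mx coefCM det_add1_mulC; congr (_ * _).
rewrite -scalemxAr -map_mxM /= -trmx_mul.
set M := B *m P.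
have -> : 1%:M + ('X - 1) *: map_mx polyC M^T =
   map_mx polyC (1%:M - M^T) + 'X *: map_mx polyC M^T.
  by rewrite map_mxB map_mx1 scalerBl scale1r addrA addrAC.
by rewrite coef_det_linear det_tr.
Qed.

(** Each minor of the weighted matrix picks up one factor 'X for every marked
    column that it uses.  Degree d, the number of marked columns, singles out
    the minors using all of them. *)
Lemma sum_minors_containing N M d (A : 'M[K]_(N, M)) (B : 'M[K]_(M, N))
    (t : 'I_d -> 'I_M) : injective t ->
  \sum_(f : {ffun 'I_N -> 'I_M} | incr f && [forall r, t r \in codom f])
     \det (colsub f A) * \det (rowsub f B) =
  (tilted_det (A *m B) (colsub t A *m rowsub t B))`_d.
Proof.
move=> tinj.
pose u (k : 'I_M) : {poly K} := if k \in codom t then 'X else 1.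
pose D := diag_mx (\row_k u k).
have -> : tilted_det (A *m B) (colsub t A *m rowsub t B) =
    \det ((map_mx polyC A *m D) *m map_mx polyC B).
  congr (\det _); apply/matrixP => p q; rewrite !mxE.
  rewrite !rmorph_sum /= mulr_sumr.
  transitivity (\sum_(k < M) (A p k * B k q)%:P +
      \sum_(k in codom t) ('X - 1) * (A p k * B k q)%:P).
    congr (_ + _); rewrite (eq_bigl (mem (t @: 'I_d))) => [|k]; last first.
      by apply/codomP/imsetP => -[r]; [exists r|move=> _ ->; exists r].
    rewrite big_imset /=; last by move=> r s _ _; exact: tinj.
    by apply: eq_bigr => r _; rewrite !mxE.
  rewrite [X in _ + X]big_mkcond -big_split /=; apply: eq_bigr => k _.
  rewrite /D mul_mx_diag !mxE /u polyCM; case: ifP => _; ring.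
rewrite cauchy_binet coef_sum [LHS]big_mkcondr; apply: eq_bigr => f incf.
have -> : colsub f (map_mx polyC A *m D) =
    map_mx polyC (colsub f A) *m diag_mx (\row_i u (f i)).
  by apply/matrixP => i j; rewrite /D !mul_mx_diag !mxE.
have -> : rowsub f (map_mx polyC B) = map_mx polyC (rowsub f B).
  by apply/matrixP => i j; rewrite !mxE.
rewrite det_mulmx !det_map_mx det_diag /=.
under [\prod_(i < N) _]eq_bigr do rewrite mxE /u.
rewrite -big_mkcond /= prodr_const mulrAC -polyCM coefCM coefXn.
have finj := incr_inj incf.
rewrite [X in (d == X)](_ : _ = #|[pred k | (k \in codom f) && (k \in codom t)]|); last first.
  rewrite -(fintype.card_image finj); apply: eq_card => k; rewrite !inE.
  apply/fintype.imageP/andP => [[i it ->]|[/codomP[i ->] kt]]; first by rewrite codom_f.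
  by exists i.
have dE : d = #|codom t| by rewrite card_codom // card_ord.
have -> : (d == #|[pred k | (k \in codom f) && (k \in codom t)]|) =
   [forall r, t r \in codom f].
  apply/eqP/forallP => [dk r|tf].
    have sub : [pred k | (k \in codom f) && (k \in codom t)] \subset codom t.
      by apply/fintype.subsetP => k; rewrite inE => /andP[].
    have := subset_cardP (etrans (esym dk) dE) sub (t r).
    by rewrite inE codom_f andbT => ->.
  rewrite [LHS]dE; apply: eq_card => k; rewrite !inE; case: (boolP (k \in codom t));
    last by rewrite andbF.
  by move=> /codomP[r ->]; rewrite tf.
by case: ifP => _; rewrite ?mulr1 ?mulr0.
Qed.

End FiniteCorrelation.

(** * The limit of the Gram matrices *)

Section GramLimit.
Variable R : realType.
Implicit Types (xs ys : seq R) (s : int).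

Lemma hsym_ge0 xs k : (forall x, x \in xs -> 0 <= x) -> 0 <= hsym xs k.
Proof.
elim: xs k => [|x xs IH] k xs0 /=; first exact: ler0n.
apply: sumr_ge0 => j _; apply: mulr_ge0; first by rewrite exprn_ge0 // xs0 ?mem_head.
by apply: IH => y yxs; rewrite xs0 // inE yxs orbT.
Qed.

Lemma hsymZ_ge0 xs s : (forall x, x \in xs -> 0 <= x) -> 0 <= hsymZ xs s.
Proof. by case: s => [k|k] // xs0; exact: hsym_ge0. Qed.

(** Multiplying the partial sums by 1 - x removes the variable x, up to a
    nonnegative boundary term. *)
Lemma sum_hsym_bounded xs : (forall x, x \in xs -> 0 <= x < 1) ->
  exists C : R, forall M, \sum_(k < M) hsym xs k <= C.
Proof.
elim: xs => [|x xs IH] xs01.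
  exists 1 => -[|M]; rewrite ?big_ord0 //.
  by rewrite big_ord_recl /= big1 ?addr0.
have [C hC] : exists C : R, forall M, \sum_(k < M) hsym xs k <= C.
  by apply: IH => y yxs; rewrite xs01 // inE yxs orbT.
have /andP[x0 x1] := xs01 x (mem_head _ _).
exists (C / (1 - x)) => M.
rewrite ler_pdivlMr ?subr_gt0 //.
have xs0 y : y \in x :: xs -> 0 <= y by move=> /xs01/andP[].
suff H : \sum_(k < M) hsym (x :: xs) k <= C + x * \sum_(k < M) hsym (x :: xs) k.
  by rewrite mulrBr mulr1 lerBlDr [_ * x]mulrC.
case: M => [|M]; first by rewrite !big_ord0 mulr0 addr0; have := hC 0%N; rewrite big_ord0.
rewrite [X in _ <= C + x * X]big_ord_recr big_ord_recl.
under eq_bigr do rewrite lift0 hsymS.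
rewrite big_split /= -mulr_sumr addrA mulrDr addrA.
have -> : hsym (x :: xs) 0 + \sum_(i < M) hsym xs i.+1 = \sum_(i < M.+1) hsym xs i.
  by rewrite big_ord_recl !hsym0.
have := hC M.+1; have : 0 <= x * hsym (x :: xs) M by rewrite mulr_ge0 ?hsym_ge0.
move=> /=; lra.
Qed.

Definition gram_part xs ys s (M : nat) : R :=
  \sum_(k < M) hsym xs k * hsymZ ys (k%:Z + s).

(** The coefficient of z^s in F(ys;z) F(xs;1/z), as a convergent series. *)
Definition gram xs ys s : R := limn (gram_part xs ys s).

Definition unit_itv xs := forall x : R, x \in xs -> 0 <= x < 1.

Lemma cvg_gram xs ys s : unit_itv xs -> unit_itv ys ->
  gram_part xs ys s @ \oo --> gram xs ys s.
Proof.
move=> X01 Y01.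
have X0 x : x \in xs -> 0 <= x by move=> /X01/andP[].
have Y0 x : x \in ys -> 0 <= x by move=> /Y01/andP[].
have [CX hCX] := sum_hsym_bounded X01; have [CY hCY] := sum_hsym_bounded Y01.
have hY k : hsymZ ys k <= CY.
  have CY0 : 0 <= CY by have := hCY 0%N; rewrite big_ord0.
  case: k => //= k; apply: le_trans (hCY k.+1); rewrite big_ord_recr /= lerDr.
  by apply: sumr_ge0 => i _; exact: hsym_ge0.
apply: nondecreasing_is_cvgn.
  apply/nondecreasing_seqP => n; rewrite /gram_part big_ord_recr /= lerDl.
  by rewrite mulr_ge0 ?hsym_ge0 ?hsymZ_ge0.
exists (CX * CY) => _ [M _ <-].
have CY0 : 0 <= CY by have := hCY 0%N; rewrite big_ord0.
apply: le_trans (_ : (\sum_(k < M) hsym xs k) * CY <= _); last by rewrite ler_wpM2r.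
by rewrite mulr_suml; apply: ler_sum => k _; rewrite ler_wpM2l ?hsym_ge0.
Qed.

(** Exchanging the two families of variables reverses the Laurent series. *)
Lemma gram_sym xs ys s : unit_itv xs -> unit_itv ys -> gram xs ys s = gram ys xs (- s).
Proof.
move=> X01 Y01.
have nneg us vs (j : nat) : unit_itv us -> unit_itv vs -> gram us vs j = gram vs us (- j%:Z).
  move=> U01 V01; have c1 := @cvg_gram us vs j U01 V01;
    have c2 := @cvg_gram vs us (- j%:Z) V01 U01.
  apply: (cvg_unique _ c1) => //=; move: c2; rewrite -(cvg_shiftn j).
  apply: cvg_trans; apply: near_eq_cvg; near=> M.
  rewrite /= /gram_part addnC big_split_ord /= big1 ?add0r => [|k _]; last first.
    by rewrite hsymZ_neg ?mulr0 //; have := ltn_ord k; lia.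
  apply: eq_bigr => k _ /=.
  have -> : (j + k)%N%:Z - j%:Z = k by lia.
  by rewrite mulrC addnC.
case: s => j; first exact: nneg.
by rewrite NegzE opprK [RHS]nneg.
Unshelve. all: by end_near. Qed.

Lemma bdiff_cvg ys (F : int -> nat -> R) (f : int -> R) :
  (forall s, F s @ \oo --> f s) ->
  forall s, (fun M => bdiff ys (fun s => F s M) s) @ \oo --> bdiff ys f s.
Proof.
move=> Ff; elim: ys => [|y ys IH] s /=; first exact: Ff.
by apply: cvgB; [exact: IH|apply: cvgMr; exact: IH].
Qed.

Lemma bdiff_sum ys (f : int -> R) (a : nat -> R) M s :
  bdiff ys (fun s => \sum_(k < M) a k * f (k%:Z + s)) s =
  \sum_(k < M) a k * bdiff ys f (k%:Z + s).
Proof.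
elim: ys s => //= y ys IH s; rewrite !IH mulr_sumr -sumrB.
apply: eq_bigr => k _; rewrite addrA; ring.
Qed.

(** Multiplying F(ys;z) F(xs;1/z) by the product of the (1 - y z) leaves
    F(xs;1/z). *)
Lemma bdiff_gram xs ys s : unit_itv xs -> unit_itv ys ->
  bdiff ys (gram xs ys) s = hsymZ xs (- s).
Proof.
move=> X01 Y01.
have := @bdiff_cvg ys _ _ (fun s => @cvg_gram xs ys s X01 Y01) s.
move=> /(cvg_unique _); apply => //.
apply: cvg_near_cst; case: s => [[|j]|j]; near=> M;
  rewrite /gram_part bdiff_sum; under eq_bigr do rewrite bdiff_hsymZ.
- have M0 : (0 < M)%N by near: M; exact: nbhs_infty_gt.
  rewrite (bigD1 (Ordinal M0)) //= big1 => [|k k0].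
    by rewrite /delta /= mulr1 addr0.
  rewrite /delta addr0 eqz_nat.
  by move: k0; rewrite -val_eqE /= => /negPf ->; rewrite mulr0.
- by rewrite big1 // => k _; rewrite /delta -PoszD addnS eqz_nat mulr0.
- have Mj : (j.+1 < M)%N by near: M; exact: nbhs_infty_gt.
  rewrite (bigD1 (Ordinal Mj)) //= big1 => [|k k0].
    by rewrite /delta NegzE subrr eqxx mulr1 addr0.
  rewrite /delta NegzE subr_eq0 eqz_nat.
  by move: k0; rewrite -val_eqE /= => /negPf ->; rewrite mulr0.
Unshelve. all: by end_near. Qed.

Lemma fdiff_gram xs ys s : unit_itv xs -> unit_itv ys ->
  fdiff xs (gram xs ys) s = hsymZ ys s.
Proof.
move=> X01 Y01.
rewrite (eq_fdiff _ (g := fun u => gram ys xs (0 - u))) => [|u]; last first.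
  by rewrite sub0r gram_sym.
by rewrite fdiff_rev bdiff_gram // sub0r opprK.
Qed.

(** The terms with k < p vanish, so the sum over the window is a shifted partial
    sum of the series. *)
Lemma cvg_gram_window xs ys (p q : nat) : unit_itv xs -> unit_itv ys ->
  (fun M => \sum_(k < M) hsymZ xs (k%:Z - p%:Z) * hsymZ ys (k%:Z - q%:Z)) @ \oo -->
  gram xs ys (p%:Z - q%:Z).
Proof.
move=> X01 Y01; rewrite -(cvg_shiftn p).
apply: cvg_trans (@cvg_gram xs ys (p%:Z - q%:Z) X01 Y01).
apply: near_eq_cvg; near=> M => /=.
rewrite addnC big_split_ord /= big1 ?add0r => [|k _]; last first.
  by rewrite hsymZ_neg ?mul0r //; have := ltn_ord k; lia.
apply: eq_bigr => k _.
have -> : (p + k)%N%:Z - p%:Z = k by lia.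
by have -> : (p + k)%N%:Z - q%:Z = k%:Z + (p%:Z - q%:Z) by lia.
Unshelve. all: by end_near. Qed.

Definition coef_cvg (P_ : nat -> {poly R}) (P : {poly R}) :=
  forall e, (fun M => (P_ M)`_e) @ \oo --> P`_e.

Lemma cvg_bigsum (I : Type) (r : seq I) (F : I -> nat -> R) (f : I -> R) :
  (forall i, F i @ \oo --> f i) ->
  (fun M => \sum_(i <- r) F i M) @ \oo --> \sum_(i <- r) f i.
Proof.
move=> Ff; elim: r => [|i r IH].
  rewrite big_nil; under eq_fun do rewrite big_nil; exact: cvg_cst.
by rewrite big_cons; under eq_fun do rewrite big_cons; apply: cvgD.
Qed.

Lemma coef_cvg_sum (I : Type) (r : seq I) (P_ : I -> nat -> {poly R}) (P : I -> {poly R}) :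
  (forall i, coef_cvg (P_ i) (P i)) ->
  coef_cvg (fun M => \sum_(i <- r) P_ i M) (\sum_(i <- r) P i).
Proof.
move=> PP e; rewrite coef_sum; under eq_fun do rewrite coef_sum.
by apply: cvg_bigsum => i; exact: PP.
Qed.

Lemma coef_cvgM P_ Q_ P Q : coef_cvg P_ P -> coef_cvg Q_ Q ->
  coef_cvg (fun M => P_ M * Q_ M) (P * Q).
Proof.
move=> PP QQ e; rewrite coefM; under eq_fun do rewrite coefM.
by apply: cvg_bigsum => i; apply: cvgM.
Qed.

Lemma coef_cvg_cst P : coef_cvg (fun=> P) P.
Proof. by move=> e; exact: cvg_cst. Qed.

Lemma coef_cvg_prod (I : Type) (r : seq I) (P_ : I -> nat -> {poly R}) (P : I -> {poly R}) :
  (forall i, coef_cvg (P_ i) (P i)) ->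
  coef_cvg (fun M => \prod_(i <- r) P_ i M) (\prod_(i <- r) P i).
Proof.
move=> PP; elim: r => [|i r IH].
  rewrite big_nil; under eq_fun do rewrite big_nil; exact: coef_cvg_cst.
by rewrite big_cons; under eq_fun do rewrite big_cons; exact: coef_cvgM.
Qed.

Lemma coef_cvg_tilted_det N (G_ : nat -> 'M[R]_N) (G H : 'M[R]_N) :
  (forall p q, (fun M => G_ M p q) @ \oo --> G p q) ->
  coef_cvg (fun M => tilted_det (G_ M) H) (tilted_det G H).
Proof.
move=> GG; rewrite /tilted_det /determinant.
apply: coef_cvg_sum => s; apply: coef_cvgM; first exact: coef_cvg_cst.
apply: coef_cvg_prod => i e; rewrite !mxE coefD coefC.
under eq_fun do rewrite !mxE coefD coefC.
apply: cvgD; last exact: cvg_cst.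
by case: ifP => _; [exact: GG|exact: cvg_cst].
Qed.

End GramLimit.

(** * Partitions in a box and increasing functions *)

Section BoxPartitions.

Lemma nth_filter_pos (s : seq nat) j : sorted geq s ->
  nth 0%N [seq x <- s | (0 < x)%N] j = nth 0%N s j.
Proof.
have tr : transitive geq by move=> a b c ba ac; exact: leq_trans ac ba.
elim: s j => // x s IH j; rewrite [sorted _ _]/= path_sortedE // => /andP[xs ss] /=.
have [x0|] := posnP x; last by case: j => //= j; rewrite IH.
have s0 i : nth 0%N s i = 0%N.
  have [si|si] := ltnP i (size s); last by rewrite nth_default.
  by apply/eqP; rewrite -leqn0 -x0; exact: (allP xs _ (mem_nth _ si)).
by rewrite IH // s0 x0; case: j => //= j; rewrite s0.
Qed.

Lemma eq_nth_pos (s1 s2 : seq nat) : 0%N \notin s1 -> 0%N \notin s2 ->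
  (forall j, nth 0%N s1 j = nth 0%N s2 j) -> s1 = s2.
Proof.
have sz (u v : seq nat) : 0%N \notin u -> (forall j, nth 0%N u j = nth 0%N v j) ->
    (size u <= size v)%N.
  move=> u0 uv; rewrite leqNgt; apply: contra u0 => vu.
  by rewrite -(nth_default 0%N (leqnn (size v))) -uv mem_nth.
move=> s10 s20 s12; apply: (@eq_from_nth _ 0%N) => [|i _]; last exact: s12.
by apply/eqP; rewrite eqn_leq (sz _ _ s10 s12) sz // => j; rewrite s12.
Qed.

(** The inverse of lam |-> f with f i = lam_(N-i) + i.  The zeros are deleted because a
    partition is given by its positive parts. *)
Definition partition_of N M (f : {ffun 'I_N -> 'I_M}) : seq nat :=
  [seq x <- [seq (f (rev_ord j) - rev_ord j)%N | j <- enum 'I_N] | (0 < x)%N].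

Lemma incr_ge N M (f : {ffun 'I_N -> 'I_M}) (i : 'I_N) : incr f -> (i <= f i)%N.
Proof.
move=> /incrP incf; case: i => i iN; elim: i iN => // i IH iN.
have iN' := ltnW iN.
apply: leq_ltn_trans (IH iN') _.
exact: incf.
Qed.

Lemma incr_sub N M (f : {ffun 'I_N -> 'I_M}) (i j : 'I_N) : incr f ->
  (i <= j)%N -> (f i - i <= f j - j)%N.
Proof.
move=> incf; case: j => j jN; case: i => i iN /=.
elim: j jN => [|j IH] jN; first by case: i iN => // iN _; rewrite (bool_irrelevance iN jN).
rewrite leq_eqVlt => /orP[/eqP e|ij].
  by subst i; rewrite (bool_irrelevance iN jN).
have jN' := ltnW jN; apply: leq_trans (IH jN' ij) _.
have H : (f (Ordinal jN') < f (Ordinal jN))%N by apply: (incrP f incf).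
rewrite leq_subLR; move: H; have := incr_ge (Ordinal jN) incf => /=; lia.
Qed.

Lemma nth_partition_of N M (f : {ffun 'I_N -> 'I_M}) (j : 'I_N) : incr f ->
  nth 0%N (partition_of f) j = (f (rev_ord j) - rev_ord j)%N.
Proof.
move=> incf; rewrite nth_filter_pos; last first.
  rewrite sorted_map.
  have : sorted (@ltord N) (enum 'I_N) by exact: ltord_sorted_enum.
  apply: sub_sorted => a b; rewrite /ltord => ab /=.
  apply: incr_sub => //=; lia.
by rewrite (nth_map j) ?size_enum_ord // nth_ord_enum.
Qed.

Lemma size_partition_of N M (f : {ffun 'I_N -> 'I_M}) : (size (partition_of f) <= N)%N.
Proof.
rewrite size_filter (leq_trans (count_size _ _)) // size_map size_enum_ord //.
Qed.

Lemma partitions_partition_of N M (f : {ffun 'I_N -> 'I_M}) : incr f ->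
  partitions (partition_of f).
Proof.
move=> incf; rewrite /partitions /=; apply/andP; split.
  have tr : transitive geq by move=> a b c ba ac; exact: leq_trans ac ba.
  apply: sorted_filter => //; rewrite sorted_map.
  have : sorted (@ltord N) (enum 'I_N) by exact: ltord_sorted_enum.
  apply: sub_sorted => a b; rewrite /ltord => ab /=.
  apply: incr_sub => //=; lia.
by rewrite mem_filter ltnn.
Qed.

(** Deleting the zeros of a nonincreasing list does not change its entries, read
    with default value 0, so f can be recovered. *)
Lemma partition_ofK N M (f : {ffun 'I_N -> 'I_M}) (i : 'I_N) : incr f ->
  (nth 0%N (partition_of f) (rev_ord i) + i)%N = f i.
Proof.
by move=> incf; rewrite nth_partition_of // rev_ordK subnK // incr_ge.
Qed.

Lemma partition_of_inj N M (f g : {ffun 'I_N -> 'I_M}) : incr f -> incr g ->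
  partition_of f = partition_of g -> f = g.
Proof.
move=> incf incg fg; apply/ffunP => i; apply/val_inj.
by rewrite /= -!partition_ofK // fg.
Qed.

Definition boxed N M (lam : seq nat) : Prop :=
  [/\ partitions lam, (size lam <= N)%N & (nth 0%N lam 0 + N <= M)%N].

Lemma partition_nth_le lam i j : partitions lam -> (i <= j)%N ->
  (nth 0%N lam j <= nth 0%N lam i)%N.
Proof.
move=> /andP[srt _] ij; have [jl|jl] := ltnP j (size lam); last by rewrite nth_default.
have tr : transitive geq by move=> a b c ba ac; exact: leq_trans ac ba.
by apply: (sorted_leq_nth tr leqnn) => //; rewrite inE // (leq_ltn_trans ij).
Qed.

Lemma boxed_partition_of N M lam : boxed N M lam ->
  exists2 f : {ffun 'I_N -> 'I_M}, incr f & partition_of f = lam.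
Proof.
move=> [lp ls lM].
have fM (i : 'I_N) : (nth 0%N lam (rev_ord i) + i < M)%N.
  apply: leq_trans lM; rewrite -addnS; apply: leq_add; last exact: ltn_ord.
  exact: partition_nth_le.
pose f := [ffun i : 'I_N => Ordinal (fM i)].
have incf : incr f.
  apply/incrP => i j ij; rewrite !ffunE /= -addnS; apply: leq_add => //.
  by apply: partition_nth_le => //=; lia.
exists f => //; apply: eq_nth_pos.
- by case/andP: (partitions_partition_of incf).
- by case/andP: lp.
move=> j; have [jN|jN] := ltnP j N; last first.
  by rewrite !nth_default // (leq_trans _ jN) // size_partition_of.
rewrite (nth_partition_of (Ordinal jN)) // ffunE /= addnK; congr (nth _ _ _); lia.
Qed.

Lemma partition_of_boxed N M (f : {ffun 'I_N -> 'I_M}) : (N <= M)%N -> incr f ->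
  boxed N M (partition_of f).
Proof.
move=> NM incf; split; [exact: partitions_partition_of|exact: size_partition_of|].
case: N f NM incf => [|N] f NM incf.
  by rewrite nth_default ?add0n // size_partition_of.
rewrite (nth_partition_of ord0) //= subSS subn0.
have := incr_ge (rev_ord ord0) incf; have := ltn_ord (f (rev_ord ord0)) => /=; lia.
Qed.

Definition box N M : seq (seq nat) :=
  [seq partition_of f | f <- enum [pred f : {ffun 'I_N -> 'I_M} | incr f]].

Lemma box_uniq N M : uniq (box N M).
Proof.
rewrite map_inj_in_uniq ?enum_uniq // => f g; rewrite !mem_enum !inE.
exact: partition_of_inj.
Qed.

Lemma mem_boxP N M lam : (N <= M)%N -> reflect (boxed N M lam) (lam \in box N M).
Proof.
move=> NM; apply: (iffP mapP) => [[f]|/boxed_partition_of[f incf <-]].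
  by rewrite mem_enum inE => incf ->; exact: partition_of_boxed.
by exists f => //; rewrite mem_enum.
Qed.

End BoxPartitions.

(** * Sums over partitions as limits over boxes *)

Section SumOverPartitions.
Variable R : realType.

Lemma ler_sum_uniq (T : eqType) (s S : seq T) (r : T -> R) : uniq s -> uniq S ->
  (forall x, x \in S -> 0 <= r x) -> (forall x, x \in s -> x \notin S -> r x = 0) ->
  \sum_(x <- s) r x <= \sum_(x <- S) r x.
Proof.
move=> us uS r0 rz.
rewrite (bigID (mem S)) /= [X in _ + X]big_seq_cond [X in _ + X]big1 ?addr0; last first.
  by move=> x /andP[]; exact: rz.
rewrite -big_filter (perm_big [seq x <- S | x \in s]); last first.
  apply: uniq_perm; rewrite ?filter_uniq // => x; rewrite !mem_filter.
  by rewrite andbC.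
rewrite big_filter big_mkcond big_seq [leRHS]big_seq; apply: ler_sum => x xS.
by case: ifP => // _; exact: r0.
Qed.

(** The boxes exhaust the partitions with at most N parts, which carry all
    the mass.  As r is nonnegative there, the sums over boxes increase, and
    every finite sum is bounded by the sum over some box. *)
Lemma esum_partitions_limit (N n0 : nat) (r : seq nat -> R) (p : R) :
  (N <= n0)%N ->
  (forall M lam, lam \in box N M -> 0 <= r lam) ->
  (forall lam, partitions lam -> (N < size lam)%N -> r lam = 0) ->
  (fun n => \sum_(lam <- box N (n + n0)) r lam) @ \oo --> p ->
  (\esum_(lam in partitions) (r lam)%:E = p%:E)%E.
Proof.
move=> Nn0 r0 rz cvp.
set u := (fun n => _) in cvp.
have mono : {homo u : m n / (m <= n)%N >-> m <= n}.
  move=> m n mn; apply: ler_sum_uniq; rewrite ?box_uniq //; first by move=> x; exact: r0.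
  move=> lam /mem_boxP[|lp ls lM]; first by rewrite (leq_trans Nn0) ?leq_addl.
  move=> /mem_boxP; case; first by rewrite (leq_trans Nn0) ?leq_addl.
  by split => //; apply: leq_trans lM _; rewrite leq_add2r.
have up n : u n <= p.
  rewrite -(cvg_lim _ cvp) //; apply: nondecreasing_cvgn_le => //.
  by apply/cvg_ex; exists p.
apply/eqP; rewrite eq_le; apply/andP; split.
  apply: ub_ereal_sup => _ [A [finA Ap] <-].
  have [s sA] := finite_fsetP.1 finA.
  rewrite sA -fsbig_seq ?fset_uniq // sumEFin lee_fin.
  (* All the parts in the finite set are at most m, so the box of width m contains
     those of its elements that have at most N parts. *)
  pose m := \max_(lam <- s) (nth 0%N lam 0).
  apply: le_trans (up (m + N)%N).
  apply: ler_sum_uniq; rewrite ?fset_uniq ?box_uniq //; first by move=> x; exact: r0.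
  move=> lam ls lnot; have lp : partitions lam by apply: Ap; rewrite sA.
  apply: rz => //; rewrite ltnNge; apply: contra lnot => szl.
  apply/mem_boxP; first by rewrite (leq_trans Nn0) ?leq_addl.
  split => //; rewrite (@leq_trans (m + N)%N) ?leq_addr // leq_add2r.
  by rewrite /m; exact: leq_bigmax_seq.
have lb n : ((u n)%:E <= \esum_(lam in partitions) (r lam)%:E)%E.
  apply: esum_ge; exists [set` box N (n + n0)].
    split; first exact: finite_seq.
    move=> lam /= /mem_boxP[|//]; by rewrite (leq_trans Nn0) ?leq_addl.
  by rewrite -fsbig_seq ?box_uniq // sumEFin.
case E: (\esum_(lam in partitions) (r lam)%:E)%E => [e| |].
- rewrite lee_fin; apply: (ler_cvg_to cvp (cvg_cst e)); near=> n.
  by have := lb n; rewrite E lee_fin.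
- by rewrite leey.
- by have := lb 0%N; rewrite E.
Unshelve. all: by end_near. Qed.

End SumOverPartitions.

(** * Linearity and upper bounds for circle integrals *)

Section ComplexCircle.
Variable R : realType.
Local Notation C := R[i].
Local Notation normc := (@Normc.normc R).
Local Notation mu := (@lebesgue_measure R).
Local Notation I2pi := (`[0, 2 * pi : R]%classic).

(** Continuity of the real and imaginary parts, which are the functions that
    circle_integral integrates. *)
Definition ccont (g : R -> C) :=
  continuous (fun t => complex.Re (g t)) /\ continuous (fun t => complex.Im (g t)).

Lemma ccont_cst (c : C) : ccont (fun=> c).
Proof. by split => t; exact: cvg_cst. Qed.

Lemma ccontD f g : ccont f -> ccont g -> ccont (fun t => f t + g t).
Proof.
move=> [f1 f2] [g1 g2]; split => t.
  rewrite (_ : (fun t => _) = (fun t => complex.Re (f t) + complex.Re (g t))).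
    by apply: cvgD; [exact: f1|exact: g1].
  by apply/funext => u; case: (f u) (g u) => ? ? [].
rewrite (_ : (fun t => _) = (fun t => complex.Im (f t) + complex.Im (g t))).
  by apply: cvgD; [exact: f2|exact: g2].
by apply/funext => u; case: (f u) (g u) => ? ? [].
Qed.

Lemma ccontM f g : ccont f -> ccont g -> ccont (fun t => f t * g t).
Proof.
move=> [f1 f2] [g1 g2]; split => t.
  rewrite (_ : (fun t => _) = (fun t => complex.Re (f t) * complex.Re (g t)
       - complex.Im (f t) * complex.Im (g t))).
    by apply: cvgB; apply: cvgM; [exact: f1|exact: g1|exact: f2|exact: g2].
  by apply/funext => u; case: (f u) (g u) => ? ? [].
rewrite (_ : (fun t => _) = (fun t => complex.Re (f t) * complex.Im (g t)
       + complex.Im (f t) * complex.Re (g t))).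
  by apply: cvgD; apply: cvgM; [exact: f1|exact: g2|exact: f2|exact: g1].
by apply/funext => u; case: (f u) (g u) => ? ? [].
Qed.

Lemma ccontV f : ccont f -> (forall t, f t != 0) -> ccont (fun t => (f t)^-1).
Proof.
move=> [f1 f2] f0.
pose n2 t := complex.Re (f t) * complex.Re (f t) + complex.Im (f t) * complex.Im (f t).
have n20 t : n2 t != 0.
  rewrite /n2 -!expr2 paddr_eq0 ?sqr_ge0 // !sqrf_eq0; have := f0 t.
  by rewrite eq_complex.
have n2c : continuous n2.
  by move=> t; apply: cvgD; apply: cvgM; [exact: f1|exact: f1|exact: f2|exact: f2].
have n2V : continuous (fun t => (n2 t)^-1) by move=> t; apply: cvgV (n2c t).
split => t.
  rewrite (_ : (fun t => _) = (fun t => complex.Re (f t) * (n2 t)^-1)).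
    by apply: cvgM; [exact: f1|exact: n2V].
  by apply/funext => u; rewrite /n2 -!expr2; case: (f u).
rewrite (_ : (fun t => _) = (fun t => - (complex.Im (f t) * (n2 t)^-1))).
  by apply: cvgN; apply: cvgM; [exact: f2|exact: n2V].
by apply/funext => u; rewrite /n2 -!expr2; case: (f u).
Qed.

Lemma ccontX f k : ccont f -> ccont (fun t => f t ^+ k).
Proof.
move=> cf; elim: k => [|k IH].
  by under eq_fun do rewrite expr0; exact: ccont_cst.
by under eq_fun do rewrite exprS; exact: ccontM.
Qed.

Lemma ccont_exprz f (k : int) : ccont f -> (forall t, f t != 0) -> ccont (fun t => f t ^ k).
Proof.
move=> cf f0; case: k => k; first exact: ccontX.
under eq_fun do rewrite NegzE -exprz_inv -exprnP.
by apply: ccontX; exact: ccontV.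
Qed.

Lemma ccont_prod (T : Type) (s : seq T) (F : T -> R -> C) :
  (forall x, ccont (F x)) -> ccont (fun t => \prod_(x <- s) F x t).
Proof.
move=> cF; elim: s => [|x s IH].
  by under eq_fun do rewrite big_nil; exact: ccont_cst.
by under eq_fun do rewrite big_cons; exact: ccontM.
Qed.

Lemma ccont_circle (r : R) : ccont (circle r).
Proof.
split => t /=; apply: cvgM; try exact: cvg_cst.
  exact: continuous_cos.
exact: continuous_sin.
Qed.

Lemma circle_speedE (r t : R) : circle_speed r t = 'i%C * circle r t.
Proof. by rewrite /circle /circle_speed; simpc. Qed.

Lemma normc_circle (r t : R) : 0 < r -> normc (circle r t) = r.
Proof.
move=> r0; rewrite /circle /= !exprMn -mulrDr cos2Dsin2 mulr1 sqrtr_sqr gtr0_norm //.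
Qed.

Lemma circle_neq0 (r t : R) : 0 < r -> circle r t != 0.
Proof.
move=> r0; apply/eqP => /(congr1 normc); rewrite normc_circle // Normc.normc0.
by move=> r00; rewrite r00 ltxx in r0.
Qed.

Lemma integrable_cont (h : R -> R) : continuous h -> mu.-integrable I2pi (EFin \o h).
Proof.
move=> ch; apply: continuous_compact_integrable; first exact: segment_compact.
exact: continuous_subspaceT.
Qed.

Definition arc_int (g : R -> C) : C :=
  (Rintegral mu I2pi (fun t => complex.Re (g t))) +i*
  (Rintegral mu I2pi (fun t => complex.Im (g t))).

Lemma circle_integralE r f :
  circle_integral r f = arc_int (fun t => f (circle r t) * circle_speed r t).
Proof. by []. Qed.

Lemma arc_int_lin f g c : ccont f -> ccont g ->
  arc_int (fun t => f t + c * g t) = arc_int f + c * arc_int g.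
Proof.
move=> [f1 f2] [g1 g2]; case: c => a b; rewrite /arc_int.
have mI : measurable I2pi by exact: measurable_itv.
have cZ (e : R) (h : R -> R) : continuous h -> continuous (fun t => e * h t).
  by move=> ch t; apply: cvgM; [exact: cvg_cst|exact: ch].
have cD (h1 h2 : R -> R) : continuous h1 -> continuous h2 -> continuous (fun t => h1 t + h2 t).
  by move=> c1 c2 t; apply: cvgD; [exact: c1|exact: c2].
have lin (h1 h2 h3 : R -> R) (e2 e3 : R) : continuous h1 -> continuous h2 -> continuous h3 ->
   Rintegral mu I2pi (fun t => h1 t + (e2 * h2 t + e3 * h3 t)) =
   Rintegral mu I2pi h1 + (e2 * Rintegral mu I2pi h2 + e3 * Rintegral mu I2pi h3).
  move=> c1 c2 c3; rewrite RintegralD //; last 2 first.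
    exact: integrable_cont.
    by apply: integrable_cont; apply: cD; exact: cZ.
  rewrite RintegralD //; last 2 first.
    by apply: integrable_cont; exact: cZ.
    by apply: integrable_cont; exact: cZ.
  by rewrite !RintegralZl //; exact: integrable_cont.
apply/eqP; rewrite eq_complex /=; apply/andP; split; apply/eqP.
  rewrite (_ : (fun t => _) = (fun t => complex.Re (f t) +
      (a * complex.Re (g t) + (- b) * complex.Im (g t)))).
    by rewrite lin // mulNr.
  by apply/funext => u; case: (f u) (g u) => ? ? [? ?] /=; rewrite mulNr.
rewrite (_ : (fun t => _) = (fun t => complex.Im (f t) +
    (a * complex.Im (g t) + b * complex.Re (g t)))).
  by rewrite lin.
by apply/funext => u; case: (f u) (g u) => ? ? [? ?].
Qed.

Lemma ccont_speed f r : ccont (fun t => f (circle r t)) ->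
  ccont (fun t => f (circle r t) * circle_speed r t).
Proof.
move=> cf; apply: ccontM => //.
rewrite (_ : circle_speed r = fun t => 'i%C * circle r t).
  by apply: ccontM; [exact: ccont_cst|exact: ccont_circle].
by apply/funext => t; exact: circle_speedE.
Qed.

Lemma circle_integral_lin r (f g : C -> C) c :
  ccont (fun t => f (circle r t)) -> ccont (fun t => g (circle r t)) ->
  circle_integral r (fun z => f z + c * g z) =
  circle_integral r f + c * circle_integral r g.
Proof.
move=> cf cg; rewrite !circle_integralE -arc_int_lin; try exact: ccont_speed.
by congr arc_int; apply/funext => t; ring.
Qed.

Lemma eq_circle_integral r (f g : C -> C) :
  (forall t, f (circle r t) = g (circle r t)) ->
  circle_integral r f = circle_integral r g.
Proof.
move=> fg; rewrite !circle_integralE; congr arc_int; apply/funext => t.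
by rewrite fg.
Qed.

(** The integrand h is only compared with f + c g on the circle, where the
    relations between powers of z with negative exponents hold. *)
Lemma circle_integral_lin_eq r (h f g : C -> C) c :
  ccont (fun t => f (circle r t)) -> ccont (fun t => g (circle r t)) ->
  (forall t, h (circle r t) = f (circle r t) + c * g (circle r t)) ->
  circle_integral r h = circle_integral r f + c * circle_integral r g.
Proof.
by move=> cf cg hfg; rewrite -circle_integral_lin //; exact: eq_circle_integral.
Qed.

Lemma circle_integral0 (r : R) : circle_integral r (fun=> 0) = 0.
Proof.
rewrite circle_integralE (_ : (fun t => _) = (fun=> 0)); last first.
  by apply/funext => t; rewrite mul0r.
by rewrite /arc_int /= !Rintegral_cst ?mul0r //; exact: measurable_itv.
Qed.

Lemma circle_integralZ r (g : C -> C) c : ccont (fun t => g (circle r t)) ->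
  circle_integral r (fun z => c * g z) = c * circle_integral r g.
Proof.
move=> cg; rewrite -[RHS]add0r -[X in X + _](circle_integral0 r) -circle_integral_lin //.
  by apply: eq_circle_integral => t; rewrite add0r.
exact: ccont_cst.
Qed.

Lemma circle_integral_sum r (n : nat) (a : nat -> C) (g : nat -> C -> C) :
  (forall k, ccont (fun t => g k (circle r t))) ->
  circle_integral r (fun z => \sum_(k < n) a k * g k z) =
  \sum_(k < n) a k * circle_integral r (g k).
Proof.
move=> cg; elim: n => [|n IH].
  rewrite big_ord0 -[RHS](circle_integral0 r); apply: eq_circle_integral => t.
  by rewrite big_ord0.
rewrite big_ord_recr /= -IH -circle_integral_lin //.
  by apply: eq_circle_integral => t; rewrite big_ord_recr.
elim: {IH} n => [|n IH]; first by under eq_fun do rewrite big_ord0; exact: ccont_cst.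
under eq_fun do rewrite big_ord_recr /=.
by apply: ccontD => //; apply: ccontM => //; exact: ccont_cst.
Qed.

Lemma normc_continuous g : ccont g -> continuous (fun t => normc (g t)).
Proof.
move=> [g1 g2] t.
rewrite (_ : (fun t => _) = (fun t => Num.sqrt (complex.Re (g t) * complex.Re (g t) +
   complex.Im (g t) * complex.Im (g t)))); last first.
  by apply/funext => u; case: (g u) => a b /=; rewrite !expr2.
apply: continuous_cvg; first exact: sqrt_continuous.
by apply: cvgD; apply: cvgM; [exact: g1|exact: g1|exact: g2|exact: g2].
Qed.

Lemma normc_ge0 (z : C) : 0 <= normc z.
Proof. by case: z => a b; exact: sqrtr_ge0. Qed.

Lemma Re_le_normc (z : C) : `|complex.Re z| <= normc z.
Proof.
case: z => a b /=; rewrite -sqrtr_sqr ler_sqrt ?addr_ge0 ?sqr_ge0 //.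
by rewrite lerDl sqr_ge0.
Qed.

Lemma Im_le_normc (z : C) : `|complex.Im z| <= normc z.
Proof.
case: z => a b /=; rewrite -sqrtr_sqr ler_sqrt ?addr_ge0 ?sqr_ge0 //.
by rewrite lerDr sqr_ge0.
Qed.

Lemma normc_le_ReIm (z : C) : normc z <= `|complex.Re z| + `|complex.Im z|.
Proof.
case: z => a b /=; rewrite -[leRHS]ger0_norm ?addr_ge0 // -sqrtr_sqr ler_sqrt ?sqr_ge0 //.
by rewrite sqrrD !real_normK ?num_real // addrAC lerDl mulrn_wge0 // mulr_ge0.
Qed.

Lemma normcX (z : C) k : normc (z ^+ k) = normc z ^+ k.
Proof.
elim: k => [|k IH]; first by rewrite !expr0 Normc.normc1.
by rewrite !exprS Normc.normcM IH.
Qed.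

Lemma normc_exprz (z : C) (k : int) : normc (z ^ k) = normc z ^ k.
Proof.
case: k => k; first by rewrite -!exprnP normcX.
by rewrite !NegzE -!exprz_inv -!exprnP normcX Normc.normcV.
Qed.

(** The bound is uniform in the exponent k; the constant is 2 r times the integral
    of the modulus of f with respect to the angle. *)
Lemma normc_circle_integral_bound r (f : C -> C) : 0 < r ->
  ccont (fun t => f (circle r t)) ->
  exists B : R, forall k : int,
    normc (circle_integral r (fun z => f z * z ^ k)) <= B * r ^ k.
Proof.
move=> r0 cf.
have mI : measurable I2pi by exact: measurable_itv.
pose J := Rintegral mu I2pi (fun t => normc (f (circle r t))).
exists (2 * r * J) => k; rewrite circle_integralE /arc_int.
pose g t := f (circle r t) * circle r t ^ k * circle_speed r t.
have cg : ccont g.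
  apply: (@ccont_speed (fun z => f z * z ^ k)); apply: ccontM => //.
  by apply: ccont_exprz; [exact: ccont_circle|move=> t; exact: circle_neq0].
have ng t : normc (g t) = r * r ^ k * normc (f (circle r t)).
  rewrite /g !Normc.normcM normc_exprz normc_circle // circle_speedE Normc.normcM.
  rewrite normc_circle //= !expr0n expr1n add0r sqrtr1 mul1r; ring.
have bnd (h : R -> R) : continuous h -> (forall t, `|h t| <= normc (g t)) ->
    `|Rintegral mu I2pi h| <= r * r ^ k * J.
  move=> ch hg; apply: (le_trans (le_normr_Rintegral _ (integrable_cont ch))) => //.
  rewrite -RintegralZl //; last by apply: integrable_cont; exact: normc_continuous.
  apply: le_Rintegral => //.
  - by apply: integrable_cont => t; apply: cvg_norm; exact: ch.
  - apply: integrable_cont => t; apply: cvgM; first exact: cvg_cst.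
    exact: (normc_continuous cf).
  - by move=> t _; rewrite -ng.
apply: (le_trans (normc_le_ReIm _)) => /=.
have -> : 2 * r * J * r ^ k = r * r ^ k * J + r * r ^ k * J by ring.
apply: lerD; apply: bnd; try by case: cg.
  by move=> t; exact: Re_le_normc.
by move=> t; exact: Im_le_normc.
Qed.

End ComplexCircle.

(** * Circle integrals of powers *)

Section PowerIntegrals.
Variable R : realType.
Local Notation C := R[i].
Local Notation normc := (@Normc.normc R).
Local Notation mu := (@lebesgue_measure R).
Local Notation I2pi := (`[0, 2 * pi : R]%classic).

Definition cis (t : R) : C := cos t +i* sin t.

Lemma circle_cis (r t : R) : circle r t = r%:C * cis t.
Proof. by rewrite /circle /cis; simpc. Qed.

Lemma cisD a b : cis (a + b) = cis a * cis b.
Proof. by rewrite /cis cosD sinD; simpc; congr (_ +i* _); ring. Qed.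

Lemma cis0 : cis 0 = 1.
Proof. by rewrite /cis cos0 sin0. Qed.

Lemma cis_neq0 t : cis t != 0.
Proof.
apply/eqP => e; have := cisD t (- t); rewrite e mul0r subrr cis0 => /eqP.
by rewrite oner_eq0.
Qed.

Lemma cisN t : cis (- t) = (cis t)^-1.
Proof.
by apply: (mulfI (cis_neq0 t)); rewrite -cisD subrr cis0 divff // cis_neq0.
Qed.

Lemma cisMz t (k : int) : cis t ^ k = cis (k%:~R * t).
Proof.
have nat_case (n : nat) : cis t ^+ n = cis (n%:R * t).
  elim: n => [|n IH]; first by rewrite mul0r cis0 expr0.
  by rewrite exprS IH -cisD -natr1 mulrDl mul1r addrC.
case: k => n; first by rewrite -exprnP nat_case.
by rewrite NegzE -exprz_inv -exprnP exprVn nat_case -cisN mulrNz mulNr.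
Qed.

Lemma cis_2pi (k : int) : cis (k%:~R * (2 * pi)) = 1.
Proof.
rewrite -cisMz (_ : cis _ = 1) ?exp1rz //.
by rewrite /cis mulr_natl cos2pi sin2pi.
Qed.

Lemma Rintegral_FTC (h H : R -> R) : continuous h ->
  (forall t : R, is_derive t (1 : R) H (h t)) ->
  Rintegral mu I2pi h = H (2 * pi) - H 0.
Proof.
move=> ch dH; rewrite /Rintegral.
have dvH (t : R) : derivable H t (1 : R) by exact: ex_derive.
have cH : continuous H by move=> t; apply: differentiable_continuous; apply/derivable1_diffP.
rewrite (@continuous_FTC2 _ h H 0 (2 * pi)) //.
- by rewrite mulr_gt0 // pi_gt0.
- exact: continuous_subspaceT.
- split; first by move=> t _; exact: dvH.
  + by apply: cvg_at_right_filter; exact: cH.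
  + by apply: cvg_at_left_filter; exact: cH.
- by move=> t _; rewrite derive1E derive_val.
Qed.

(** The antiderivatives sin(kt)/k and -cos(kt)/k take the same value at 0 and
    at 2 pi. *)
Lemma arc_int_cis (k : int) : k != 0 -> arc_int (fun t => cis (k%:~R * t)) = 0.
Proof.
move=> k0; have k0' : k%:~R != 0 :> R by rewrite intr_eq0.
have [c2 s2] : cos (k%:~R * (2 * pi)) = 1 :> R /\ sin (k%:~R * (2 * pi)) = 0 :> R.
  by have := cis_2pi k; rewrite /cis => -[].
have ck : continuous (fun t : R => k%:~R * t).
  by move=> t; apply: cvgM; [exact: cvg_cst|exact: cvg_id].
have Dk (t : R) : is_derive t 1 (fun t : R => k%:~R * t) k%:~R.
  by apply: is_derive_eq; rewrite /GRing.scale /= mulr1.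
have dS (t : R) : is_derive t (1 : R) (fun t => k%:~R^-1 * sin (k%:~R * t)) (cos (k%:~R * t)).
  have H := @is_derive1_comp _ sin _ t _ _ (is_derive_sin _) (Dk t).
  apply: (@is_derive_eq _ _ _ _ _ _ _ _ (@is_deriveZ _ _ _ _ k%:~R^-1 _ _ _ H)).
  by rewrite /GRing.scale /=; field.
have dC (t : R) : is_derive t (1 : R) (fun t => - (k%:~R^-1 * cos (k%:~R * t))) (sin (k%:~R * t)).
  have H := @is_derive1_comp _ cos _ t _ _ (is_derive_cos _) (Dk t).
  apply: (@is_derive_eq _ _ _ _ _ _ _ _ (is_deriveN (@is_deriveZ _ _ _ _ k%:~R^-1 _ _ _ H))).
  by rewrite /GRing.scale /=; field.
rewrite /arc_int; apply/eqP; rewrite eq_complex /=; apply/andP; split; apply/eqP.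
  rewrite (Rintegral_FTC _ dS).
    by rewrite s2 !mulr0 sin0 mulr0 subrr.
  by move=> t; exact: (continuous_comp (ck t) (@continuous_cos R _)).
rewrite (Rintegral_FTC _ dC).
  by rewrite c2 mulr0 cos0 subrr.
by move=> t; exact: (continuous_comp (ck t) (@continuous_sin R _)).
Qed.

Lemma circle_integral_exprz (r : R) (k : int) : 0 < r ->
  circle_integral r (fun z => z ^ k) = (2 * pi)%:C * 'i%C * (k == -1)%:R.
Proof.
move=> r0; rewrite circle_integralE.
have rC0 : r%:C != 0 by rewrite fmorph_eq0 gt_eqF.
have ccis (n : int) : ccont (fun t : R => cis (n%:~R * t)).
  have cn : continuous (fun t : R => n%:~R * t).
    by move=> t; apply: cvgM; [exact: cvg_cst|exact: cvg_id].
  split => t; first exact: (continuous_comp (cn t) (@continuous_cos R _)).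
  exact: (continuous_comp (cn t) (@continuous_sin R _)).
have E t : circle r t ^ k * circle_speed r t = 0 + 'i%C * r%:C ^ (k + 1) * cis ((k + 1)%:~R * t).
  rewrite circle_speedE add0r mulrCA -[circle r t ^ k * _](@expfzDr _ _ k 1);
    last exact: circle_neq0.
  by rewrite circle_cis expfzMl cisMz mulrA.
rewrite (_ : (fun t => _) = (fun t => 0 + 'i%C * r%:C ^ (k + 1) * cis ((k + 1)%:~R * t)));
  last first.
  exact/funext.
rewrite arc_int_lin //; last exact: ccont_cst.
have -> : arc_int (fun=> 0) = 0 :> C.
  by rewrite /arc_int /= !Rintegral_cst ?mul0r //; exact: measurable_itv.
rewrite add0r; have [->|k1] := eqVneq k (-1).
  rewrite addNr expr0z mulr1 mulr1.
  have -> : arc_int (fun t => cis ((0 : int)%:~R * t)) = (2 * pi)%:C.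
    rewrite (_ : (fun t => _) = (fun=> 1)); last first.
      by apply/funext => t; rewrite mul0r cis0.
    rewrite /arc_int /= !Rintegral_cst ?mul0r; [|exact: measurable_itv|exact: measurable_itv].
    rewrite mul1r; have := @lebesgue_measure_itv R `[0, 2 * pi : R].
    by rewrite /= lte_fin mulr_gt0 ?pi_gt0 // -EFinB subr0 => ->.
  by rewrite mulrC.
rewrite arc_int_cis ?mulr0 //; apply: contra k1 => /eqP k1.
by apply/eqP; rewrite -[LHS](addrK 1) k1 sub0r.
Qed.

End PowerIntegrals.

(** * Uniqueness for first order recurrences *)

Section GeometricUniqueness.
Variable R : realType.
Local Notation C := R[i].
Local Notation normc := (@Normc.normc R).

(** Iterating the recurrence n times, D s = x^n D (s - n), whose modulus is at
    most B rho^s (|x| / rho)^n and tends to 0. *)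
Lemma geometric_unique (D : int -> C) (x : C) (rho B : R) (s0 s1 : int) :
  0 < rho -> normc x < rho ->
  (forall s, s <= s0 -> D s = x * D (s - 1)) ->
  (forall s, s <= s1 -> normc (D s) <= B * rho ^ s) ->
  forall s, s <= s0 -> D s = 0.
Proof.
move=> rho0 xrho Dx DB s ss0.
have Dk (k : nat) : D s = x ^+ k * D (s - k%:Z).
  elim: k => [|k IH]; first by rewrite expr0 mul1r subr0.
  rewrite IH exprSr -mulrA Dx; last by lia.
  by congr (_ * (_ * D _)); lia.
have rho_neq0 : rho != 0 by rewrite gt_eqF.
have bound (k : nat) : s - k%:Z <= s1 -> normc (D s) <= B * rho ^ s * (normc x / rho) ^+ k.
  move=> ks; rewrite (Dk k) Normc.normcM normcX.
  apply: le_trans (ler_wpM2l _ (DB _ ks)) _; first by rewrite exprn_ge0 // normc_ge0.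
  rewrite expfzDr // exprMn exprVn -exprnN.
  by rewrite le_eqVlt; apply/orP; left; apply/eqP; ring.
apply: Normc.eq0_normc; apply/eqP; rewrite eq_le normc_ge0 andbT.
have cv : (fun k => B * rho ^ s * (normc x / rho) ^+ k) @ \oo --> (0 : R).
  apply: cvg_geometric; rewrite ger0_norm ?divr_ge0 ?normc_ge0 ?ltW //.
  by rewrite ltr_pdivrMr // mul1r.
apply: (ler_cvg_to (cvg_cst (normc (D s))) cv); near=> k.
apply: bound; have : (`|s - s1| <= k)%N by near: k; exact: nbhs_infty_ge.
lia.
Unshelve. all: by end_near. Qed.

End GeometricUniqueness.

(** * Laurent coefficients as circle integrals *)

Section ClosedForms.
Variable R : realType.
Local Notation C := R[i].
Local Notation normc := (@Normc.normc R).
Implicit Types (xs ys : seq R).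

Definition twopii : C := (2 * pi)%:C * 'i%C.

Definition one_sub_prod xs (u : C) : C := \prod_(x <- xs) (1 - x%:C * u).

Lemma one_sub_prod_cons x xs u : one_sub_prod (x :: xs) u = (1 - x%:C * u) * one_sub_prod xs u.
Proof. by rewrite /one_sub_prod big_cons. Qed.

Lemma normc_real (x : R) : 0 <= x -> normc x%:C = x.
Proof. by move=> x0; rewrite /= expr0n addr0 sqrtr_sqr ger0_norm. Qed.

Lemma one_sub_neq0 (u : C) : normc u < 1 -> 1 - u != 0.
Proof.
move=> u1; rewrite subr_eq0; apply/eqP => e; move: u1.
by rewrite -e Normc.normc1 ltxx.
Qed.

Lemma one_sub_prod_neq0 xs u : (forall x, x \in xs -> 0 <= x) ->
  (forall x, x \in xs -> x * normc u < 1) -> one_sub_prod xs u != 0.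
Proof.
move=> x0 xu; rewrite /one_sub_prod prodf_seq_neq0; apply/allP => x xxs /=.
by apply: one_sub_neq0; rewrite Normc.normcM normc_real ?x0 // xu.
Qed.

Lemma ccont_one_sub_prod xs (g : R -> C) : ccont g -> ccont (fun t => one_sub_prod xs (g t)).
Proof.
move=> cg; rewrite /one_sub_prod; apply: ccont_prod => x; apply: ccontD; first exact: ccont_cst.
rewrite (_ : (fun t => _) = (fun t => (- x%:C) * g t)); last by apply/funext => t; rewrite mulNr.
by apply: ccontM => //; exact: ccont_cst.
Qed.

Lemma ccont_circleV (r : R) : 0 < r -> ccont (fun t => (circle r t)^-1).
Proof. by move=> r0; apply: ccontV; [exact: ccont_circle|move=> t; exact: circle_neq0]. Qed.

Lemma ccont_circlez (r : R) (k : int) : 0 < r -> ccont (fun t => circle r t ^ k).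
Proof. by move=> r0; apply: ccont_exprz; [exact: ccont_circle|move=> t; exact: circle_neq0]. Qed.

(** The function F(xs;z) / F(ys;1/z); its inverse is symb_inv. *)
Definition symb xs ys (z : C) : C := one_sub_prod ys z^-1 * (one_sub_prod xs z)^-1.

Lemma one_sub_prod_circle_neq0 xs (r : R) t : 0 < r ->
  (forall x, x \in xs -> 0 <= x /\ x * r < 1) -> one_sub_prod xs (circle r t) != 0.
Proof.
move=> r0 H; apply: one_sub_prod_neq0 => x /H[] // x0; by rewrite normc_circle.
Qed.

Lemma ccont_symb xs ys (r : R) : 0 < r ->
  (forall x, x \in xs -> 0 <= x /\ x * r < 1) ->
  ccont (fun t => symb xs ys (circle r t)).
Proof.
move=> r0 H; apply: ccontM; first by apply: ccont_one_sub_prod; exact: ccont_circleV.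
by apply: ccontV => [|t]; [apply: ccont_one_sub_prod;
  exact: ccont_circle|exact: one_sub_prod_circle_neq0].
Qed.

(** A variable of ys reduces the integral to a combination of two integrals without
    it.  For a variable x of xs, both sides satisfy the recurrence obtained by multiplying
    by 1 - x z.  Their difference is bounded by a multiple of (1/r)^k where the right
    side vanishes, and x < 1/r. *)
Lemma integral_symb xs ys (r : R) (s : int) : 0 < r ->
  (forall x, x \in xs -> 0 <= x /\ x * r < 1) ->
  circle_integral r (fun z => symb xs ys z * z ^ s) = twopii * (symb_coef xs ys (- s - 1))%:C.
Proof.
move=> r0 H; elim: ys s => [|y ys IH] s; last first.
  have E t : symb xs (y :: ys) (circle r t) * circle r t ^ s =
     symb xs ys (circle r t) * circle r t ^ s +
     (- y%:C) * (symb xs ys (circle r t) * circle r t ^ (s - 1)).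
    rewrite /symb one_sub_prod_cons expfzDr ?circle_neq0 //.
    rewrite -[circle r t ^ (-1)]/((circle r t)^-1); ring.
  rewrite (@circle_integral_lin_eq _ r _ (fun z => symb xs ys z * z ^ s)
    (fun z => symb xs ys z * z ^ (s - 1)) (- y%:C)
    (ccontM (ccont_symb ys r0 H) (ccont_circlez _ r0))
    (ccontM (ccont_symb ys r0 H) (ccont_circlez _ r0)) E).
  rewrite !IH /symb_coef fdiff_cons rmorphB rmorphM /=.
  have -> : - (s - 1) - 1 = - s - 1 + 1 by lia.
  ring.
elim: xs s H => [|x xs IH] s H.
  have E t : symb [::] [::] (circle r t) * circle r t ^ s = circle r t ^ s.
    by rewrite /symb /one_sub_prod !big_nil invr1 !mul1r.
  rewrite (@eq_circle_integral _ r _ (fun z => z ^ s)) //.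
  rewrite circle_integral_exprz // -/twopii; congr (_ * _).
  rewrite /symb_coef /= hsymZ_nil /delta.
  have -> : (- s - 1 == 0) = (s == -1) by apply/eqP/eqP; lia.
  by case: (s == -1).
have Hxs u : u \in xs -> 0 <= u /\ u * r < 1 by move=> uxs; apply: H; rewrite inE uxs orbT.
have [x0 xr] := H x (mem_head _ _).
pose D k := circle_integral r (fun z => symb (x :: xs) [::] z * z ^ (- k))
  - twopii * (symb_coef (x :: xs) [::] (k - 1))%:C.
suff D0 : D (- s) = 0 by move/eqP: D0; rewrite /D opprK subr_eq0 => /eqP.
have [B HB] := normc_circle_integral_bound r0 (ccont_symb [::] r0 H).
apply: (@geometric_unique R D x%:C r^-1 B (- s) 0) => //.
- by rewrite invr_gt0.
- by rewrite normc_real // -[_^-1]mul1r ltr_pdivlMr.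
- move=> k _; rewrite /D.
  have E t : symb xs [::] (circle r t) * circle r t ^ (- k) =
     symb (x :: xs) [::] (circle r t) * circle r t ^ (- k) +
     (- x%:C) * (symb (x :: xs) [::] (circle r t) * circle r t ^ (- (k - 1))).
    rewrite opprB addrC expfzDr ?circle_neq0 // -[circle r t ^ 1]/(circle r t).
    rewrite /symb one_sub_prod_cons invfM.
    have nz : 1 - x%:C * circle r t != 0.
      by apply: one_sub_neq0; rewrite Normc.normcM normc_real // normc_circle.
    field.
    by rewrite nz (one_sub_prod_circle_neq0 _ r0 Hxs).
  have := @circle_integral_lin_eq _ r (fun z => symb xs [::] z * z ^ (- k))
    (fun z => symb (x :: xs) [::] z * z ^ (- k))
    (fun z => symb (x :: xs) [::] z * z ^ (- (k - 1))) (- x%:C) _ _ E.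
  rewrite IH // opprK {1}/symb_coef /= -(hsymZ_cons x) rmorphB rmorphM /= => e.
  apply/eqP; rewrite -subr_eq0; apply/eqP.
  move: (e (ccontM (ccont_symb [::] r0 H) (ccont_circlez _ r0))
           (ccontM (ccont_symb [::] r0 H) (ccont_circlez _ r0))).
  move=> /esym/eqP; rewrite -subr_eq0 => /eqP {}e.
  by rewrite -[RHS]e /symb_coef /=; ring.
- move=> k k0; rewrite /D.
  have -> : symb_coef (x :: xs) [::] (k - 1) = 0 by apply: hsymZ_neg; lia.
  by rewrite rmorph0 mulr0 subr0 exprz_inv; exact: HB.
Qed.

Definition symb_inv xs ys (w : C) : C := one_sub_prod xs w * (one_sub_prod ys w^-1)^-1.

Lemma one_sub_prod_circleV_neq0 ys (r : R) t : 0 < r ->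
  (forall y, y \in ys -> 0 <= y < r) -> one_sub_prod ys (circle r t)^-1 != 0.
Proof.
move=> r0 H; apply: one_sub_prod_neq0 => y /H /andP[y0 yr] //.
by rewrite Normc.normcV normc_circle // ltr_pdivrMr // mul1r.
Qed.

Lemma ccont_symb_inv xs ys (r : R) : 0 < r ->
  (forall y, y \in ys -> 0 <= y < r) -> ccont (fun t => symb_inv xs ys (circle r t)).
Proof.
move=> r0 H; apply: ccontM; first by apply: ccont_one_sub_prod; exact: ccont_circle.
apply: ccontV => [|t]; last exact: one_sub_prod_circleV_neq0.
by apply: ccont_one_sub_prod; exact: ccont_circleV.
Qed.

(** The value, for |z| larger than the radius of the circle, of the integral of
    symb_inv(w) w^j / (w - z).  The terms of the Laurent expansion of
    symb_inv(w) w^j with nonnegative exponents contribute nothing, and the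
    others contribute minus 2 pi i times their value at z.  There are finitely many terms of
    the first kind, and they are the ones subtracted here; any Rb > j + |xs|
    includes all of them. *)
Definition symb_inv_transform xs ys (z : C) (Rb : nat) (j : int) : C :=
  - twopii * (z ^ j * symb_inv xs ys z
     - \sum_(r < Rb) (symb_inv_coef xs ys (r%:Z - j))%:C * z ^+ r).

Section CauchyTransform.
Variables (r1 r2 : R) (z : C).
Hypotheses (r20 : 0 < r2) (r21 : r2 < r1) (nz : normc z = r1).

Let z0 : z != 0.
Proof.
apply/eqP => e; move: nz; rewrite e Normc.normc0 => r10.
by move: (lt_trans r20 r21); rewrite -r10 ltxx.
Qed.

Let wz t : circle r2 t - z != 0.
Proof.
rewrite subr_eq0; apply/eqP => /(congr1 normc).
by rewrite normc_circle // nz => e; move: r21; rewrite e ltxx.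
Qed.

Let ccont_wz : ccont (fun t => (circle r2 t - z)^-1).
Proof.
by apply: ccontV => //; apply: ccontD; [exact: ccont_circle|exact: ccont_cst].
Qed.

Let MI xs ys (j : int) (w : C) := (w - z)^-1 * symb_inv xs ys w * w ^ j.
Let M xs ys j := circle_integral r2 (MI xs ys j).

Let ccontM_symb_inv xs ys (j : int) : (forall y, y \in ys -> 0 <= y < r2) ->
  ccont (fun t => MI xs ys j (circle r2 t)).
Proof.
move=> H; apply: ccontM; last exact: ccont_circlez.
by apply: ccontM => //; exact: ccont_symb_inv.
Qed.

(** The integral of w^j / (w - z): multiplying by w - z gives a recurrence of ratio
    z when j increases, hence of ratio 1/z in k = - j.  For j >= 0 the
    closed form is zero and the integral is bounded by a multiple of r2^j, which is
    smaller than |z|^j. *)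
Lemma integral_symb_inv_nil (Rb : nat) (j : int) : j < Rb%:Z ->
  M [::] [::] j = symb_inv_transform [::] [::] z Rb j.
Proof.
move=> jRb.
have -> : symb_inv_transform [::] [::] z Rb j = - twopii * (z ^ j * (j < 0)%R%:R).
  rewrite /symb_inv_transform; congr (_ * _).
  rewrite /symb_inv /one_sub_prod !big_nil invr1 !mulr1; case: (boolP (j < 0)) => [j0|];
    last rewrite -leNgt => j0.
    rewrite big1 ?subr0 ?mulr1 // => i _.
    by rewrite /symb_inv_coef /= hsymZ_nil /delta oppr_eq0 subr_eq0 gt_eqF ?mul0r // (lt_le_trans j0).
  case: j jRb j0 => // j jRb _; rewrite ltz_nat in jRb.
  rewrite (bigD1 (Ordinal jRb)) //= big1 => [|i ij]; rewrite /symb_inv_coef /= hsymZ_nil /delta.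
    by rewrite subrr oppr0 eqxx mul1r addr0 subrr mulr0.
  rewrite oppr_eq0 subr_eq0 eqz_nat.
  by move: ij; rewrite -val_eqE /= => /negPf ->; rewrite mul0r.
pose D k := M [::] [::] (- k) + twopii * (z ^ (- k) * (- k < 0)%R%:R).
suff D0 : D (- j) = 0.
  by move/eqP: D0; rewrite /D opprK addr_eq0 -mulNr => /eqP.
have H0 (y : R) : y \in [::] -> 0 <= y < r2 by [].
have cw : ccont (fun t => (circle r2 t - z)^-1 * symb_inv [::] [::] (circle r2 t)).
  by apply: ccontM => //; exact: ccont_symb_inv.
have [B HB] := normc_circle_integral_bound (f := fun w =>
  (w - z)^-1 * symb_inv [::] [::] w) r20 cw.
apply: (@geometric_unique R D z^-1 r2^-1 B (- j) 0) => //.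
- by rewrite invr_gt0.
- by rewrite Normc.normcV nz ltf_pV2 // posrE // (lt_trans r20).
- move=> k _; rewrite /D.
  have E t : circle r2 t ^ (- k) = MI [::] [::] (- (k - 1)) (circle r2 t) +
     (- z) * MI [::] [::] (- k) (circle r2 t).
    rewrite /MI opprB addrC expfzDr ?circle_neq0 // -[circle r2 t ^ 1]/(circle r2 t).
    by rewrite /symb_inv /one_sub_prod !big_nil; field; rewrite wz.
  have := @circle_integral_lin_eq _ r2 (fun w => w ^ (- k)) (MI [::] [::] (- (k - 1)))
    (MI [::] [::] (- k)) (- z) (ccontM_symb_inv _ _ H0) (ccontM_symb_inv _ _ H0) E.
  rewrite circle_integral_exprz // -/twopii -!/(M _ _ _) => e.
  have -> : M [::] [::] (- (k - 1)) = twopii * (- k == -1)%:R + z * M [::] [::] (- k).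
    by rewrite e; ring.
  rewrite mulrDr mulrDr [z^-1 * (z * _)]mulKf //.
  rewrite [_ * _ + M _ _ _]addrC -addrA; congr (_ + _).
  have -> : - (k - 1) = - k + 1 by ring.
  rewrite expfzDr // -[z ^ 1]/z.
  have [->|k1] := eqVneq (- k) (-1); first by rewrite addNr ltxx ltrN10 !mulr1 ?mulr0 addr0 mulrC.
  rewrite mulr0 mulr0 add0r.
  have -> : (- k + 1 < 0) = (- k < 0) by move: k1 => /eqP k1; apply/idP/idP; lia.
  by field.
- move=> k k0; rewrite /D.
  have -> : (- k < 0) = false by lia.
  by rewrite mulr0 mulr0 addr0 exprz_inv; exact: HB.
Qed.

Lemma symb_inv_coef_gt xs ys s : (size xs)%:Z < s -> symb_inv_coef xs ys s = 0.
Proof.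
rewrite /symb_inv_coef; elim: xs s => [|x xs IH] s /= ss; first by rewrite hsymZ_neg //; lia.
by rewrite !IH ?mulr0 ?subr0 //; lia.
Qed.

(** Without ys the symbol is a polynomial in w, and each factor 1 - x w acts as a
    finite difference in j. *)
Lemma integral_symb_inv_nilY xs (Rb : nat) (j : int) : j + (size xs)%:Z < Rb%:Z ->
  M xs [::] j = symb_inv_transform xs [::] z Rb j.
Proof.
have H0 (y : R) : y \in [::] -> 0 <= y < r2 by [].
elim: xs j => [|x xs IH] j jRb; first by apply: integral_symb_inv_nil; move: jRb => /=; lia.
have E t : MI (x :: xs) [::] j (circle r2 t) =
  MI xs [::] j (circle r2 t) + (- x%:C) * MI xs [::] (j + 1) (circle r2 t).
  rewrite /MI expfzDr ?circle_neq0 // -[circle r2 t ^ 1]/(circle r2 t).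
  by rewrite /symb_inv one_sub_prod_cons; ring.
rewrite /M (circle_integral_lin_eq (ccontM_symb_inv _ _ H0) (ccontM_symb_inv _ _ H0) E).
rewrite -!/(M _ _ _) !IH; try by move: jRb => /=; lia.
rewrite /symb_inv_transform expfzDr // -[z ^ 1]/z /symb_inv one_sub_prod_cons.
have -> : \sum_(r < Rb) (symb_inv_coef (x :: xs) [::] (r%:Z - j))%:C * z ^+ r =
   \sum_(r < Rb) (symb_inv_coef xs [::] (r%:Z - j))%:C * z ^+ r -
   x%:C * \sum_(r < Rb) (symb_inv_coef xs [::] (r%:Z - (j + 1)))%:C * z ^+ r.
  rewrite mulr_sumr -sumrB; apply: eq_bigr => r _.
  rewrite {1}/symb_inv_coef bdiff_cons rmorphB rmorphM /= -!/(symb_inv_coef _ _ _).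
  by rewrite opprD addrA; ring.
ring.
Qed.

(** Multiplying by 1 - y / w gives a recurrence of ratio y.  For very negative
    j the closed form is a multiple of z^j, which r2^j dominates since r2 < |z|,
    and y < r2. *)
Lemma integral_symb_inv xs ys (Rb : nat) (j : int) :
  (forall y, y \in ys -> 0 <= y < r2) -> j + (size xs)%:Z < Rb%:Z ->
  M xs ys j = symb_inv_transform xs ys z Rb j.
Proof.
elim: ys j => [|y ys IH] j H jRb; first exact: integral_symb_inv_nilY.
have Hys u : u \in ys -> 0 <= u < r2 by move=> uys; apply: H; rewrite inE uys orbT.
have /andP[y0 yr2] := H y (mem_head _ _).
have yz : 1 - y%:C * z^-1 != 0.
  apply: one_sub_neq0; rewrite Normc.normcM Normc.normcV normc_real // nz.
  by rewrite ltr_pdivrMr ?mul1r ?(lt_trans yr2) // (lt_trans r20).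
have Pz : one_sub_prod ys z^-1 != 0.
  apply: one_sub_prod_neq0 => u /Hys/andP[u0 ur] //.
  by rewrite Normc.normcV nz ltr_pdivrMr ?mul1r ?(lt_trans ur) // (lt_trans r20).
pose D k := M xs (y :: ys) k - symb_inv_transform xs (y :: ys) z Rb k.
suff D0 : D j = 0 by move/eqP: D0; rewrite /D subr_eq0 => /eqP.
have cw : ccont (fun t => (circle r2 t - z)^-1 * symb_inv xs (y :: ys) (circle r2 t)).
  by apply: ccontM => //; exact: ccont_symb_inv.
have [B HB] := normc_circle_integral_bound (f := fun w =>
  (w - z)^-1 * symb_inv xs (y :: ys) w) r20 cw.
(* B bounds the integral and the second summand the closed form. *)
pose B' := B + normc (twopii * symb_inv xs (y :: ys) z).
apply: (@geometric_unique R D y%:C r2 B' j (- (size xs)%:Z - 1)) => //.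
- by rewrite normc_real.
- move=> k kj.
  have E t : MI xs ys k (circle r2 t) = MI xs (y :: ys) k (circle r2 t) +
    (- y%:C) * MI xs (y :: ys) (k - 1) (circle r2 t).
    rewrite /MI expfzDr ?circle_neq0 // -[circle r2 t ^ (-1)]/((circle r2 t)^-1).
    have yw : 1 - y%:C * (circle r2 t)^-1 != 0.
      apply: one_sub_neq0; rewrite Normc.normcM Normc.normcV normc_real // normc_circle //.
      by rewrite ltr_pdivrMr ?mul1r.
    have Pw := one_sub_prod_circleV_neq0 t r20 Hys.
    set c := (circle r2 t)^-1 in yw Pw *; rewrite /symb_inv one_sub_prod_cons invfM -/c.
    set P := one_sub_prod ys c in Pw *.
    have -> : (1 - y%:C * c)^-1 * P^-1 = P^-1 / (1 - y%:C * c) by rewrite mulrC.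
    have F : P^-1 = P^-1 / (1 - y%:C * c) - y%:C * c * (P^-1 / (1 - y%:C * c)).
      by rewrite -[X in X - _]mul1r -mulrBl mulrC divfK.
    rewrite {1}F; ring.
  have := circle_integral_lin_eq (ccontM_symb_inv _ _ H) (ccontM_symb_inv _ _ H) E.
  rewrite -!/(M _ _ _) IH //; last by lia.
  move=> e.
  have E2 : symb_inv_transform xs ys z Rb k = symb_inv_transform xs (y :: ys) z Rb k
     - y%:C * symb_inv_transform xs (y :: ys) z Rb (k - 1).
    rewrite /symb_inv_transform expfzDr // -[z ^ (-1)]/(z^-1).
    have -> : \sum_(r < Rb) (symb_inv_coef xs ys (r%:Z - k))%:C * z ^+ r =
       \sum_(r < Rb) (symb_inv_coef xs (y :: ys) (r%:Z - k))%:C * z ^+ r -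
       y%:C * \sum_(r < Rb) (symb_inv_coef xs (y :: ys) (r%:Z - (k - 1)))%:C * z ^+ r.
      rewrite mulr_sumr -sumrB; apply: eq_bigr => r _.
      have -> : symb_inv_coef xs ys (r%:Z - k) =
         symb_inv_coef xs (y :: ys) (r%:Z - k) - y * symb_inv_coef xs (y :: ys) (r%:Z - (k - 1)).
        have -> : r%:Z - (k - 1) = (r%:Z - k) + 1 by ring.
        have hrec : (fun s : int => hsymZ ys (- s)) =1
            (fun s : int => hsymZ (y :: ys) (- s) - y * hsymZ (y :: ys) (- (s + 1))).
          by move=> s; rewrite opprD hsymZ_cons.
        rewrite /symb_inv_coef -[X in _ = _ - _ * X]bdiff_shift -bdiff_lin.
        exact: (eq_bdiff xs hrec).
      by rewrite rmorphB rmorphM /=; ring.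
    have -> : symb_inv xs ys z = (1 - y%:C * z^-1) * symb_inv xs (y :: ys) z.
      by rewrite /symb_inv one_sub_prod_cons invfM [RHS]mulrCA mulVKf.
    ring.
  rewrite /D; apply/eqP; rewrite -subr_eq0; apply/eqP.
  move: e; rewrite E2 => /eqP; rewrite -subr_eq0 => /eqP e.
  by rewrite -oppr0 -e; ring.
- move=> k kn; rewrite /D /symb_inv_transform big1 ?subr0 => [|r _]; last first.
    by rewrite symb_inv_coef_gt ?rmorph0 ?mul0r //; have : 0 <= r%:Z by []; lia.
  rewrite mulNr opprK.
  apply: le_trans (le_normcD _ _) _; rewrite mulrDl; apply: lerD; first exact: HB.
  rewrite mulrCA Normc.normcM mulrC ler_wpM2l ?normc_ge0 // normc_exprz nz.
  case: k kn => k kn; first by lia.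
  rewrite !NegzE -!exprz_inv -!exprnP lerXn2r ?nnegrE ?invr_ge0 ?ltW //.
    by rewrite (lt_trans r20).
  by rewrite ltf_pV2 // posrE // (lt_trans r20).
Qed.
End CauchyTransform.

End ClosedForms.

(** * The kernel in closed form *)

Section KernelClosedForm.
Variable R : realType.
Local Notation C := R[i].
Local Notation normc := (@Normc.normc R).

Lemma cauchyF_one_sub_prod (xs : seq R) (u : C) :
  cauchyF [seq x%:C | x <- xs] [:: u] = (one_sub_prod xs u)^-1.
Proof.
rewrite /cauchyF big_map /one_sub_prod -prodfV; apply: eq_bigr => x _.
by rewrite big_seq1.
Qed.

Lemma twopii_sqr : (4 * pi ^+ 2)^-1%:C * (- twopii R * twopii R) = 1.
Proof.
have pi0 : (pi : R) != 0 by rewrite gt_eqF // pi_gt0.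
have -> : - twopii R * twopii R = (4 * pi ^+ 2 : R)%:C.
  rewrite /twopii -mulNr mulrACA -expr2 sqr_i mulrN1 mulNr opprK -rmorphM.
  by congr (_%:C); ring.
by rewrite -rmorphM mulVf // mulf_neq0 ?expf_neq0 // pnatr_eq0.
Qed.

(** After the inner integration the integrand is a combination of z^(j-i-1) and
    of the symbol times powers of z, because the symbol and its inverse cancel in
    the first term; that term gives delta_ij. *)
Lemma kernelL_closed (X Y : {fset R}) (r1 r2 : R) (i j : int) (Rb : nat) :
  0 < r2 -> r2 < r1 ->
  (forall x, x \in (X : seq R) -> 0 <= x /\ x * r1 < 1) ->
  (forall y, y \in (Y : seq R) -> 0 <= y < r2) ->
  j + (size (X : seq R))%:Z < Rb%:Z ->
  kernelL X Y r1 r2 i j =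
  ((i == j)%:R - \sum_(r < Rb) symb_coef X Y (i - r%:Z) * symb_inv_coef X Y (r%:Z - j))%:C.
Proof.
move=> r20 r21 HX HY jRb; have r10 := lt_trans r20 r21.
rewrite /kernelL.
pose b (r : nat) := (symb_inv_coef X Y (r%:Z - j))%:C.
pose g (r : nat) (z : C) := symb X Y z * z ^ (r%:Z - i - 1).
have cg r : ccont (fun t => g r (circle r1 t)).
  by apply: ccontM; [exact: ccont_symb|exact: ccont_circlez].
rewrite (@eq_circle_integral _ r1 _ (fun z => (- twopii R) *
    (z ^ (j - i - 1) + (-1) * \sum_(r < Rb) b r * g r z))); last first.
  move=> t; set z := circle r1 t.
  have nz : normc z = r1 by exact: normc_circle.
  have z0 : z != 0 by exact: circle_neq0.
  have PX : one_sub_prod X z != 0 by exact: one_sub_prod_circle_neq0.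
  have PY : one_sub_prod Y z^-1 != 0.
    apply: one_sub_prod_circleV_neq0 => // y /HY/andP[-> /= yr]; exact: lt_trans yr r21.
  rewrite (@eq_circle_integral _ r2 _ (fun w => (symb X Y z * z ^ (- i - 1)) *
     ((w - z)^-1 * symb_inv X Y w * w ^ j))); last first.
    move=> s; rewrite !cauchyF_one_sub_prod /symb /symb_inv invfM !invrK; ring.
  have wz s : circle r2 s - z != 0.
    rewrite subr_eq0; apply/eqP => /(congr1 normc).
    by rewrite normc_circle // nz => e; move: r21; rewrite e ltxx.
  rewrite circle_integralZ; last first.
    apply: ccontM; last exact: ccont_circlez.
    apply: ccontM; last exact: ccont_symb_inv.
    by apply: ccontV => //; apply: ccontD; [exact: ccont_circle|exact: ccont_cst].
  rewrite (integral_symb_inv r20 r21 nz HY jRb) /symb_inv_transform.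
  have -> : \sum_(r < Rb) b r * g r z =
      symb X Y z * z ^ (- i - 1) * \sum_(r < Rb) b r * z ^+ r.
    rewrite mulr_sumr; apply: eq_bigr => r _; rewrite /g.
    have -> : r%:Z - i - 1 = - i - 1 + r%:Z by ring.
    by rewrite (expfzDr (- i - 1) r%:Z z0) -exprnP; ring.
  have -> : j - i - 1 = - i - 1 + j by ring.
  rewrite (expfzDr (- i - 1) j z0).
  have oi : symb X Y z * symb_inv X Y z = 1.
    by rewrite /symb /symb_inv mulrA divfK // mulfV.
  have -> : z ^ (- i - 1) * z ^ j =
      symb X Y z * symb_inv X Y z * (z ^ (- i - 1) * z ^ j) by rewrite oi mul1r.
  by rewrite /b; ring.
have cS : ccont (fun t => \sum_(r < Rb) b r * g r (circle r1 t)).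
  elim: Rb {jRb} => [|n IH]; first by under eq_fun do rewrite big_ord0; exact: ccont_cst.
  under eq_fun do rewrite big_ord_recr /=.
  by apply: ccontD => //; apply: ccontM => //; exact: ccont_cst.
rewrite circle_integralZ; last first.
  apply: ccontD; first exact: ccont_circlez.
  by apply: ccontM => //; exact: ccont_cst.
rewrite (@circle_integral_lin _ r1 (fun z => z ^ (j - i - 1))
   (fun z => \sum_(r < Rb) b r * g r z)) //; last exact: ccont_circlez.
rewrite circle_integral_exprz // -/(twopii R) circle_integral_sum //.
have -> : \sum_(k < Rb) b k * circle_integral r1 (g k) =
   twopii R * (\sum_(r < Rb) symb_coef X Y (i - r%:Z) * symb_inv_coef X Y (r%:Z - j))%:C.
  rewrite rmorph_sum mulr_sumr; apply: eq_bigr => r _.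
  rewrite /g integral_symb // rmorphM /b /=.
  have -> : - (r%:Z - i - 1) - 1 = i - r%:Z by ring.
  ring.
have -> : (j - i - 1 == -1) = (i == j) by apply/eqP/eqP; lia.
rewrite mulN1r -mulrBr [- twopii R * _]mulrA [LHS]mulrA twopii_sqr mul1r.
by rewrite rmorphB rmorph_nat.
Qed.

(** The shift by N turns the sum over r >= 0 into the sum over r >= N of the
    discrete kernel; both are cut where the coefficients of the symbol vanish. *)
Lemma kernelL_corr_kernel (X Y : {fset R}) (r1 r2 : R) (N k l : nat) :
  0 < r2 -> r2 < r1 ->
  (forall x, x \in (X : seq R) -> 0 <= x /\ x * r1 < 1) ->
  (forall y, y \in (Y : seq R) -> 0 <= y < r2) ->
  kernelL X Y r1 r2 (k%:Z - N%:Z) (l%:Z - N%:Z) = (corr_kernel X Y N k l)%:C.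
Proof.
move=> r20 r21 HX HY.
pose Rb := ((k + size (Y : seq R)).+1 + (l + size (X : seq R)).+1)%N.
rewrite (@kernelL_closed _ _ _ _ _ _ Rb) //; last by rewrite /Rb; lia.
rewrite /corr_kernel; congr (_%:C).
have -> : (k%:Z - N%:Z == l%:Z - N%:Z) = (k == l) by rewrite (inj_eq (addIr _)) eqz_nat.
congr (_ - _).
rewrite -(big_mkord xpredT (fun r : nat => symb_coef X Y (k%:Z - N%:Z - r%:Z) *
   symb_inv_coef X Y (r%:Z - (l%:Z - N%:Z)))).
have -> : \sum_(0 <= r < Rb) symb_coef X Y (k%:Z - N%:Z - r%:Z) *
   symb_inv_coef X Y (r%:Z - (l%:Z - N%:Z)) =
   \sum_(N <= r < N + Rb) symb_coef X Y (k%:Z - r%:Z) * symb_inv_coef X Y (r%:Z - l%:Z).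
  rewrite -[in RHS](add0n N) big_addn add0n addKn.
  apply: eq_bigr => r _; congr (symb_coef _ _ _ * symb_inv_coef _ _ _); lia.
have vanish (u v : nat) : ((k + size (Y : seq R)) < u)%N ->
    \sum_(u <= r < v) symb_coef X Y (k%:Z - r%:Z) * symb_inv_coef X Y (r%:Z - l%:Z) = 0.
  move=> ku; rewrite big_nat_cond big1 // => r /andP[/andP[ur _] _].
  by rewrite symb_coef_ltn ?mul0r // (leq_trans ku).
have [Nk|kN] := leqP N (k + size (Y : seq R)).+1; last first.
  by rewrite vanish ?[RHS]big_geq //; exact: ltnW.
rewrite (@big_cat_nat _ _ _ (k + size (Y : seq R)).+1) //=; last by rewrite /Rb addnCA leq_addr.
by rewrite [X in _ + X]vanish ?addr0.
Qed.

End KernelClosedForm.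

(** * Correlations of the Schur measure *)

Section SchurCorrelation.
Variable R : realType.
Implicit Types X Y : {fset R}.

Definition hsym_minor (xs : seq R) N M (f : {ffun 'I_N -> 'I_M}) : R :=
  \det (\matrix_(p < N, i < N) hsymZ xs ((f i)%:Z - p%:Z)).

Lemma hsym_minor_ge0 (xs : seq R) N M (f : {ffun 'I_N -> 'I_M}) :
  (forall x, x \in xs -> 0 <= x) -> incr f -> 0 <= hsym_minor xs f.
Proof.
move=> x0 incf.
(* The row indices 0, ..., N-1 are values below M since p <= f p < M. *)
pose g := [ffun p : 'I_N => Ordinal (leq_ltn_trans (incr_ge p incf) (ltn_ord (f p)))].
have incg : incr g by apply/incrP => i j ij; rewrite !ffunE.
have := det_hsymZ_ge0 x0 incg incf.
by congr (_ <= \det _); apply/matrixP => p i; rewrite !mxE ffunE.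
Qed.

Lemma schur_partition_of (xs : seq R) N M (f : {ffun 'I_N -> 'I_M}) :
  uniq xs -> (size xs <= N)%N -> incr f -> schur xs (partition_of f) = hsym_minor xs f.
Proof.
move=> uxs nN incf.
have /andP[_ p0] := partitions_partition_of incf.
rewrite (@schur_jacobi_trudi _ xs _ N) ?size_partition_of // /jacobi_trudi -det_rev;
  congr (\det _).
apply/matrixP => p i; rewrite !mxE -(partition_ofK i incf) /=; congr (hsymZ _ _).
by have := ltn_ord p; have := ltn_ord i; lia.
Qed.

(** The particles of index beyond N sit strictly below - N, so k - N with k >= 0
    can only be one of the first N particles. *)
Lemma particles_partition_of N M (f : {ffun 'I_N -> 'I_M}) (k : nat) : incr f ->
  particles (partition_of f) (k%:Z - N%:Z) <-> exists i, f i = k :> nat.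
Proof.
move=> incf; split=> [[i ki]|[i fi]]; last first.
  exists (rev_ord i) => /=; have := partition_ofK i incf; rewrite fi /=.
  have := ltn_ord i; lia.
have [iN|Ni] := ltnP i N; last first.
  by move: ki; rewrite nth_default ?(leq_trans _ Ni) ?size_partition_of //; lia.
exists (rev_ord (Ordinal iN)); rewrite -partition_ofK // rev_ordK /=; lia.
Qed.

Lemma cauchyF_gt0 (X Y : seq R) : unit_itv X -> unit_itv Y -> 0 < cauchyF X Y.
Proof.
move=> X01 Y01; rewrite /cauchyF big_seq; apply: prodr_gt0 => x xX.
rewrite big_seq; apply: prodr_gt0 => y yY.
have /andP[x0 x1] := X01 x xX; have /andP[y0 y1] := Y01 y yY.
by rewrite invr_gt0 subr_gt0 mulr_ilt1.
Qed.

(** The normalization of the Schur measure is the Gram determinant. *)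
Lemma det_gram_toeplitz (X Y : seq R) N : unit_itv X -> unit_itv Y -> (size X + size Y <= N)%N ->
  \det (toeplitz (gram X Y) N) = cauchyF X Y.
Proof.
move=> X01 Y01 szN.
have := @det_toeplitz _ X Y (gram X Y) N szN (fun s => bdiff_gram s X01 Y01)
   (fun s => fdiff_gram s X01 Y01).
have -> : cauchyF X Y = (\prod_(x <- X) \prod_(y <- Y) (1 - x * y))^-1.
  by rewrite /cauchyF -prodfV; apply: eq_bigr => x _; rewrite -prodfV.
move=> H; apply: (mulfI (x := \prod_(x <- X) \prod_(y <- Y) (1 - x * y))).
  by apply/eqP => e; move: H; rewrite e mul0r => /eqP; rewrite eq_sym oner_eq0.
rewrite H mulfV //; apply/eqP => e; move: H; rewrite e mul0r => /eqP.
by rewrite eq_sym oner_eq0.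
Qed.

(** For every n the sum is the coefficient of a tilted Gram determinant.  Only its
    Gram matrix depends on n, and the coefficient is a polynomial in the entries
    of that matrix, so the limit may be taken inside.  At the limit the part
    carried by the marked columns factors through the Gram matrix by
    sum_kernel_row_gram. *)
Lemma cvg_sum_minors (X Y : seq R) N d (k : 'I_d -> nat) (M0 : nat) :
  unit_itv X -> unit_itv Y -> (size X + size Y <= N)%N ->
  injective k -> (forall r, (k r < M0)%N) ->
  (fun n => \sum_(f : {ffun 'I_N -> 'I_(n + M0)} |
      incr f && [forall r, [exists i, f i == k r :> nat]])
      hsym_minor X f * hsym_minor Y f) @ \oo -->
  cauchyF X Y * \det (\matrix_(r < d, c < d) corr_kernel X Y N (k r) (k c)).
Proof.
move=> X01 Y01 szN kinj kM0.
have nN : (size X <= N)%N by apply: leq_trans szN; exact: leq_addr.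
have mN : (size Y <= N)%N by apply: leq_trans szN; exact: leq_addl.
pose G := toeplitz (gram X Y) N.
pose B : 'M[R]_(d, N) := \matrix_(r, q) kernel_row X Y N (k r) q.
pose P : 'M[R]_(N, d) := \matrix_(q, c) hsymZ Y ((k c)%:Z - q%:Z).
pose Gn n : 'M[R]_N := \matrix_(p, q)
  \sum_(l < n + M0) hsymZ X (l%:Z - p%:Z) * hsymZ Y (l%:Z - q%:Z).
have GB : G *m B^T = \matrix_(p < N, r < d) hsymZ X ((k r)%:Z - p%:Z).
  apply/matrixP => p r; rewrite !mxE.
  rewrite -(@sum_kernel_row_gram _ X Y (gram X Y) N) //; first last.
  - by move=> s; exact: fdiff_gram.
  - by move=> s; exact: bdiff_gram.
  by apply: eq_bigr => q _; rewrite !mxE mulrC.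
have BP : B *m P = \matrix_(r < d, c < d) corr_kernel X Y N (k r) (k c).
  apply/matrixP => r c; rewrite !mxE -(sum_kernel_row_hsymZ _ _ nN mN).
  by apply: eq_bigr => q _; rewrite !mxE.
rewrite -(det_gram_toeplitz X01 Y01 szN) -BP -coef_tilted_det -/G.
have cG (p q : 'I_N) : (fun n => Gn n p q) @ \oo --> G p q.
  rewrite /G [toeplitz _ _ _ _]mxE; under eq_fun do rewrite mxE.
  have := @cvg_gram_window _ X Y p q X01 Y01.
  by rewrite -(cvg_shiftn M0).
have cT := @coef_cvg_tilted_det _ N Gn G (G *m B^T *m P^T) cG.
apply: cvg_trans (cT d).
apply: near_eq_cvg; near=> n.
pose t (r : 'I_d) : 'I_(n + M0) := Ordinal (ltn_addl n (kM0 r)).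
have tinj : injective t by move=> r s /(congr1 val) /kinj.
pose A1 : 'M[R]_(N, n + M0) := \matrix_(p, l) hsymZ X (l%:Z - p%:Z).
pose A2 : 'M[R]_(n + M0, N) := \matrix_(l, q) hsymZ Y (l%:Z - q%:Z).
have -> : Gn n = A1 *m A2.
  by apply/matrixP => p q; rewrite !mxE; apply: eq_bigr => l _; rewrite !mxE.
have -> : G *m B^T *m P^T = colsub t A1 *m rowsub t A2.
  by rewrite GB; congr (_ *m _); apply/matrixP => p q; rewrite !mxE.
rewrite -sum_minors_containing //; apply: eq_big => f.
  congr (_ && _); apply: eq_forallb => r; apply/codomP/existsP => -[j].
    by move=> e; exists j; rewrite -e.
  by move=> /eqP e; exists j; apply/val_inj.
move=> _; rewrite -[\det (rowsub f A2)]det_tr /hsym_minor; congr (_ * _).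
  by congr (\det _); apply/matrixP => p i; rewrite !mxE.
by congr (\det _); apply/matrixP => p i; rewrite !mxE.
Unshelve. all: by end_near. Qed.

(** Over a box the weights are products of two minors, by Jacobi-Trudi; the
    normalization cancels the Gram determinant in the limit of their sums. *)
Theorem correlation_particles (X Y : {fset R}) N d (t : 'I_d -> int) (k : 'I_d -> nat) :
  unit_itv X -> unit_itv Y -> (size (X : seq R) + size (Y : seq R) <= N)%N ->
  injective k -> (forall r, t r = (k r)%:Z - N%:Z) ->
  correlation X Y particles (range t) =
  (\det (\matrix_(r < d, c < d) corr_kernel X Y N (k r) (k c)))%:E.
Proof.
move=> X01 Y01 szN kinj tk.
have nN : (size (X : seq R) <= N)%N by apply: leq_trans szN; exact: leq_addr.
have mN : (size (Y : seq R) <= N)%N by apply: leq_trans szN; exact: leq_addl.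
have F0 := cauchyF_gt0 X01 Y01.
(* Every box considered must contain the marked values k r and have room for N
   particles. *)
pose M0 := (N + (\max_r k r).+1)%N.
have kM0 r : (k r < M0)%N by rewrite /M0 addnS ltnS (leq_trans (leq_bigmax r)) // leq_addl.
have X0 x : x \in (X : seq R) -> 0 <= x by move=> /X01/andP[].
have Y0 y : y \in (Y : seq R) -> 0 <= y by move=> /Y01/andP[].
pose w (lam : seq nat) := \1_[set mu | range t `<=` particles mu] lam * schur_measure X Y lam.
have wE M (f : {ffun 'I_N -> 'I_M}) : incr f -> w (partition_of f) =
   (if [forall r, [exists i, f i == k r :> nat]] then hsym_minor X f * hsym_minor Y f else 0)
     / cauchyF X Y.
  move=> incf; rewrite /w /schur_measure !schur_partition_of ?fset_uniq // indicE.
  set b := (_ \in _); set b' := [forall r, _].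
  have -> : b = b'.
    apply/idP/forallP => [/set_mem /= H r|H]; last apply/mem_set => _ [r _ <-].
      have : particles (partition_of f) (t r) by apply: H; exists r.
      by rewrite tk => /(particles_partition_of _ incf)[i fi]; apply/existsP; exists i; apply/eqP.
    by rewrite tk; apply/(particles_partition_of _ incf); have /existsP[i /eqP] := H r; exists i.
  by case: b'; rewrite ?mul1r ?mul0r.
rewrite /correlation; apply: (@esum_partitions_limit _ N M0 w).
- exact: leq_addr.
- move=> M lam /mapP[f]; rewrite mem_enum inE => incf ->; rewrite wE //.
  apply: divr_ge0; last exact: ltW.
  by case: ifP => // _; rewrite mulr_ge0 // hsym_minor_ge0.
- move=> lam _ Nl; rewrite /w /schur_measure /schur leqNgt (leq_ltn_trans nN Nl) /=.
  by rewrite !mul0r mulr0.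
set D := \det _.
have -> : D = cauchyF X Y * D * (cauchyF X Y)^-1 by rewrite mulrAC mulfV ?mul1r // gt_eqF.
have := cvg_sum_minors X01 Y01 szN kinj kM0; rewrite -/D => cv.
apply: cvg_trans (cvgM cv (cvg_cst (cauchyF X Y)^-1)).
apply: near_eq_cvg; near=> n => /=.
rewrite big_map big_enum_cond /= big_mkcondr mulr_suml; apply: eq_big => f;
  first by rewrite inE andbT.
by move=> incf; rewrite wE.
Unshelve. all: by end_near. Qed.

(** The particles left out by the truncation have zero parts, so they are
    negative. *)
Lemma sub_particles_trunc (lam : seq nat) (T : set int) : (forall s, T s -> 0 <= s) ->
  (T `<=` particles_trunc lam) = (T `<=` particles lam).
Proof.
move=> T0; apply/propext; split=> H s Ts; have [j] := H s Ts; first by move=> _ ->; exists j.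
move=> sj; exists j => //; rewrite ltnNge; apply/negP => li.
by have := T0 s Ts; rewrite sj nth_default //; lia.
Qed.

End SchurCorrelation.

Theorem theorem1p1p1 (R : realType) (X Y : {fset R})
  (hX : forall x : R, x \in X -> 0 <= x < 1)
  (hY : forall y : R, y \in Y -> 0 <= y < 1)
  (r1 r2 : R) (hr2 : 0 < r2) (hr12 : r2 < r1)
  (hXr2 : forall x : R, x \in X -> x < r2)
  (hYr2 : forall y : R, y \in Y -> y < r2)
  (hXr1 : forall x : R, x \in X -> x != 0 -> r1 < x^-1)
  (hYr1 : forall y : R, y \in Y -> y != 0 -> r1 < y^-1)
  (d : nat) (t : 'I_d -> int) (ht : injective t) :
  let D := \det (\matrix_(r < d, c < d) kernelL X Y r1 r2 (t r) (t c)) in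
  (exists2 p : R, correlation X Y particles (range t) = p%:E & p%:C = D) /\
  ((forall r : 'I_d, 0 <= t r) ->
   exists2 p : R, correlation X Y particles_trunc (range t) = p%:E & p%:C = D).
Proof.
set D := \det _ => /=.
(* The last summand makes t r + N nonnegative. *)
pose N := (size (X : seq R) + size (Y : seq R) + \max_r `|t r|)%N.
pose k r := absz (t r + N%:Z).
have tk r : t r = (k r)%:Z - N%:Z.
  have : (`|t r| <= N)%N.
    by rewrite /N; apply: leq_trans (leq_addl _ _); exact: (leq_bigmax (F := fun r =>
      absz (t r))).
  by rewrite /k; lia.
have kinj : injective k by move=> r s rs; apply: ht; rewrite !tk rs.
have szN : (size (X : seq R) + size (Y : seq R) <= N)%N by exact: leq_addr.
pose p := \det (\matrix_(r < d, c < d) corr_kernel X Y N (k r) (k c)).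
have corr : correlation X Y particles (range t) = p%:E by exact: correlation_particles.
have HX x : x \in (X : seq R) -> 0 <= x /\ x * r1 < 1.
  move=> xX; have /andP[x0 _] := hX x xX; split => //.
  have [->|xn] := eqVneq x 0; first by rewrite mul0r.
  have xp : 0 < x by rewrite lt_def xn.
  by rewrite mulrC -ltr_pdivlMr // mul1r hXr1.
have HY y : y \in (Y : seq R) -> 0 <= y < r2.
  by move=> yY; have /andP[-> _] := hY y yY; rewrite hYr2.
have pD : p%:C = D.
  rewrite -[LHS]/(real_complex R p) /p -det_map_mx; congr (\det _).
  apply/matrixP => r c; rewrite !mxE !tk; apply/esym; exact: kernelL_corr_kernel.
split; first by exists p.
move=> t0; exists p => //; rewrite -corr /correlation; apply: eq_esum => lam _.
rewrite !indicE; congr (_%:R * _)%:E; congr (nat_of_bool _).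
have T0 (s : int) : range t s -> 0 <= s by move=> [r _ <-].
by apply/idP/idP => /set_mem /= H; apply/mem_set;
  rewrite /= ?(sub_particles_trunc lam T0) // -(sub_particles_trunc lam T0).
Qed.
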